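(* Let $\Omega\subseteq\mathbb H$ be an axially symmetric open set, $f$ a left slice hyperholomorphic function on $\Omega$, and $p\in\mathbb H$. Assume that $f$ admits the $*$-Laurent expansion $$f(q)=\sum_{n=0}^\infty(q-p)^{*n}a_n+\sum_{n=1}^\infty(q-p)^{-*n}a_{-n},\qquad\{a_n\}_{n\in\mathbb Z}\subseteq\mathbb H,$$ convergent absolutely and uniformly on the compact subsets of $\Omega(p,R_1,R_2)\subset\Omega$, where $\frac1{R_2}=\limsup_{n\to\infty}|a_n|^{1/n}$, $R_1=\limsup_{n\to\infty}|a_{-n}|^{1/n}$ and $0<R_1<R_2$. Then, for $q\in\Omega(p,R_1,R_2)$, $$\Delta f(q)=\sum_{n=0}^\infty\widetilde Q_n(q,p)c_n+\sum_{n=1}^\infty\mathcal M_n(q,p)\,\mathcal Q_{c,p}^{-n-1}(q)\,c_{-n},$$ the series being convergent, where $c_n=-2(n+1)(n+2)a_{n+2}$ for $n\ge0$ and $c_{-n}=-4a_{-n}$ for $n\ge1$.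
   Context: $\mathbb H$ denotes the quaternions $q=q_0+q_1e_1+q_2e_2+q_3e_3$ with the usual relations, $\underline q=q_1e_1+q_2e_2+q_3e_3$, $\bar q=q_0-\underline q$, $\mathbb S=\{\underline q:|\underline q|=1\}$, $\mathbb C_I=\mathbb R+I\mathbb R$ for $I\in\mathbb S$, $[q]=\{q_0+I|\underline q|:I\in\mathbb S\}$; a set $U$ is axially symmetric if $[q]\subset U$ for all $q\in U$. Slice hyperholomorphic: for $U$ axially symmetric open and $\mathcal U=\{(u,v)\in\mathbb R^2:u+\mathbb Sv\subset U\}$, $f:U\to\mathbb H$ is left slice hyperholomorphic if $f(u+Iv)=\alpha(u,v)+I\beta(u,v)$ for all $(u,v)\in\mathcal U$, $I\in\mathbb S$, with $C^1$ functions $\alpha,\beta:\mathcal U\to\mathbb H$, $\alpha$ even and $\beta$ odd in $v$, satisfying $\partial_u\alpha=\partial_v\beta$, $\partial_v\alpha=-\partial_u\beta$. $\Delta=\sum_{i=0}^3\partial_{q_i}^2$ in the variable $q$. $\Omega(p,R_1,R_2)$: choose $I\in\mathbb S$ with $p\in\mathbb C_I$, let $S_I(p,R_1,R_2)=\{z\in\mathbb C_I:R_1<|z-p|<R_2\}$; then $\Omega(p,R_1,R_2)=\{x+yJ:J\in\mathbb S,\ x,y\in\mathbb R,\ x+yI\text{ and }x-yI\in S_I(p,R_1,R_2)\}$. $*$-powers and products (left $*$-product in $q$): $(q-p)^{*m}=\sum_{i=0}^m\binom mi q^i(-p)^{m-i}$, $(\bar q-p)^{*k}=\sum_{j=0}^k\binom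 kj\bar q^j(-p)^{k-j}$, $(q-p)^{*m}*(\bar q-p)^{*k}=(\bar q-p)^{*k}*(q-p)^{*m}=\sum_{i=0}^m\sum_{j=0}^k\binom mi\binom kj q^i\bar q^j(-p)^{m-i+k-j}$; for $q\notin[p]$, $n\ge1$, $(q-p)^{-*n}=(q^2-2p_0q+|p|^2)^{-n}(q-\bar p)^{*n}$ with $p_0=\mathrm{Re}(p)$. $\widetilde Q_n(q,p)=2\sum_{j=0}^n\frac{n-j+1}{(n+1)(n+2)}(q-p)^{*(n-j)}*(\bar q-p)^{*j}$ ($n\ge0$); $\mathcal M_n(q,p)=\sum_{j=0}^n(n-j)(\bar q-p)^{*(n-j)}*(q-p)^{*j}$ ($n\ge1$); $\mathcal Q_{c,p}^{-m}(q)=(p^2-2q_0p+|q|^2)^{-m}$. *)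

(* Defs.v *)
From HB Require Import structures.
From mathcomp Require Import all_boot all_order all_algebra ring lra.
From mathcomp Require Import all_classical all_reals all_analysis.

Set Implicit Arguments.
Unset Strict Implicit.
Unset Printing Implicit Defensive.

Import Order.TTheory GRing.Theory Num.Theory.
Import numFieldNormedType.Exports.

Local Open Scope classical_set_scope.
Local Open Scope ring_scope.

Record quat (R : realType) := Quat { q0 : R; q1 : R; q2 : R; q3 : R }.

Section QuatStructures.
Variable R : realType.
Implicit Types (p q r : quat R) (k l : R).

Lemma quat_eq p q :
  q0 p = q0 q -> q1 p = q1 q -> q2 p = q2 q -> q3 p = q3 q -> p = q.
Proof. by case: p q => [????] [????] /= -> -> -> ->. Qed.

Definition quat_tuple q := (q0 q, q1 q, q2 q, q3 q).
Definition tuple_quat (t : R * R * R * R) :=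
  let: (a, b, c, d) := t in Quat a b c d.
Lemma quat_tupleK : cancel quat_tuple tuple_quat.
Proof. by case. Qed.

HB.instance Definition _ := Choice.copy (quat R) (can_type quat_tupleK).

Definition quat_add p q := Quat (q0 p + q0 q) (q1 p + q1 q) (q2 p + q2 q) (q3 p + q3 q).
Definition quat_opp q := Quat (- q0 q) (- q1 q) (- q2 q) (- q3 q).
Definition quat_scale k q := Quat (k * q0 q) (k * q1 q) (k * q2 q) (k * q3 q).
(* e1^2 = e2^2 = e3^2 = -1, e1 e2 = e3, e2 e3 = e1, e3 e1 = e2. *)
Definition quat_mul p q := Quat
  (q0 p * q0 q - q1 p * q1 q - q2 p * q2 q - q3 p * q3 q)
  (q0 p * q1 q + q1 p * q0 q + q2 p * q3 q - q3 p * q2 q)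
  (q0 p * q2 q - q1 p * q3 q + q2 p * q0 q + q3 p * q1 q)
  (q0 p * q3 q + q1 p * q2 q - q2 p * q1 q + q3 p * q0 q).
Definition quat_conj q := Quat (q0 q) (- q1 q) (- q2 q) (- q3 q).
Definition quat_normsq q := q0 q ^+ 2 + q1 q ^+ 2 + q2 q ^+ 2 + q3 q ^+ 2.
Definition quat_inv q := quat_scale (quat_normsq q)^-1 (quat_conj q).

Local Ltac quat_ring := repeat (case=> ? ? ? ?); apply: quat_eq => /=; ring.

Lemma quat_addA : associative quat_add. Proof. quat_ring. Qed.
Lemma quat_addC : commutative quat_add. Proof. quat_ring. Qed.
Lemma quat_add0l : left_id (Quat 0 0 0 0) quat_add. Proof. quat_ring. Qed.
Lemma quat_addNl : left_inverse (Quat 0 0 0 0) quat_opp quat_add. Proof. quat_ring. Qed.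
HB.instance Definition _ := GRing.isZmodule.Build (quat R) quat_addA quat_addC quat_add0l quat_addNl.

Lemma quat_mulA : associative quat_mul. Proof. quat_ring. Qed.
Lemma quat_mul1l : left_id (Quat 1 0 0 0) quat_mul. Proof. quat_ring. Qed.
Lemma quat_mul1r : right_id (Quat 1 0 0 0) quat_mul. Proof. quat_ring. Qed.
Lemma quat_mulDl : left_distributive quat_mul +%R. Proof. quat_ring. Qed.
Lemma quat_mulDr : right_distributive quat_mul +%R. Proof. quat_ring. Qed.
Lemma quat_oner_neq0 : Quat 1 0 0 0 != 0 :> quat R.
Proof. by apply/eqP => -[] /eqP; rewrite oner_eq0. Qed.
HB.instance Definition _ :=
  GRing.Zmodule_isNzRing.Build (quat R) quat_mulA quat_mul1l quat_mul1r quat_mulDl quat_mulDr quat_oner_neq0.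

Lemma quat_scaleA k l q : quat_scale k (quat_scale l q) = quat_scale (k * l) q.
Proof. by apply: quat_eq => /=; ring. Qed.
Lemma quat_scale1 : left_id 1 quat_scale. Proof. quat_ring. Qed.
Lemma quat_scaleDr : right_distributive quat_scale +%R.
Proof. by move=> k [????] [????]; apply: quat_eq => /=; ring. Qed.
Lemma quat_scaleDl q : {morph quat_scale^~ q : k l / k + l}.
Proof. by move=> k l; apply: quat_eq => /=; ring. Qed.
HB.instance Definition _ :=
  GRing.Zmodule_isLmodule.Build R (quat R) quat_scaleA quat_scale1 quat_scaleDr quat_scaleDl.

Lemma quat_scaleAl k p q : k *: (p * q) = k *: p * q.
Proof. by apply: quat_eq => /=; ring. Qed.
HB.instance Definition _ := GRing.Lmodule_isLalgebra.Build R (quat R) quat_scaleAl.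
Lemma quat_scaleAr k p q : k *: (p * q) = p * (k *: q).
Proof. by apply: quat_eq => /=; ring. Qed.
HB.instance Definition _ := GRing.Lalgebra_isAlgebra.Build R (quat R) quat_scaleAr.

Lemma quat_normsq_ge0 q : 0 <= quat_normsq q.
Proof. by rewrite !addr_ge0 // sqr_ge0. Qed.

Lemma quat_normsq_eq0 q : (quat_normsq q == 0) = (q == 0).
Proof.
apply/eqP/eqP => [|->]; last by rewrite /quat_normsq /= !expr0n /= !addr0.
move/eqP; rewrite /quat_normsq !paddr_eq0 ?addr_ge0 ?sqr_ge0 // !sqrf_eq0.
by move=> /andP[/andP[/andP[/eqP ? /eqP ?] /eqP ?] /eqP ?]; apply: quat_eq.
Qed.

Lemma quat_mulVl : {in [pred q | q != 0], left_inverse 1 quat_inv *%R}.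
Proof.
move=> q; rewrite inE -quat_normsq_eq0 => nz.
have e : quat_inv q * q = (quat_normsq q)^-1 *: Quat (quat_normsq q) 0 0 0.
  by rewrite /quat_inv; move: (_^-1) => k; apply: quat_eq => /=; rewrite /quat_normsq; ring.
by rewrite e; apply: quat_eq; rewrite /= ?mulr0 ?mulVf.
Qed.
Lemma quat_mulVr : {in [pred q | q != 0], right_inverse 1 quat_inv *%R}.
Proof.
move=> q; rewrite inE -quat_normsq_eq0 => nz.
have e : q * quat_inv q = (quat_normsq q)^-1 *: Quat (quat_normsq q) 0 0 0.
  by rewrite /quat_inv; move: (_^-1) => k; apply: quat_eq => /=; rewrite /quat_normsq; ring.
by rewrite e; apply: quat_eq; rewrite /= ?mulr0 ?mulVf.
Qed.
Lemma quat_unitP p q : q * p = 1 /\ p * q = 1 -> p \in [pred q | q != 0].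
Proof.
case=> e _; rewrite inE; apply/eqP => p0; move/eqP: e.
by rewrite p0 mulr0 eq_sym oner_eq0.
Qed.
Lemma quat_inv_out : {in [predC [pred q | q != 0]], quat_inv =1 id}.
Proof.
by move=> q; rewrite !inE negbK => /eqP ->; apply: quat_eq; rewrite /= ?oppr0 mulr0.
Qed.
HB.instance Definition _ :=
  GRing.NzRing_hasMulInverse.Build (quat R) quat_mulVl quat_mulVr quat_unitP quat_inv_out.

Definition quat_norm q : R := Num.sqrt (quat_normsq q).

Lemma quat_ler_normD p q : quat_norm (p + q) <= quat_norm p + quat_norm q.
Proof.
set A := quat_normsq p; set B := quat_normsq q.
have sA : 0 <= Num.sqrt A by exact: sqrtr_ge0.
have sB : 0 <= Num.sqrt B by exact: sqrtr_ge0.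
pose d := q0 p * q0 q + q1 p * q1 q + q2 p * q2 q + q3 p * q3 q.
have CS : d ^+ 2 <= A * B.
  rewrite -subr_ge0.
  have -> : A * B - d ^+ 2 =
    (q0 p * q1 q - q1 p * q0 q) ^+ 2 + (q0 p * q2 q - q2 p * q0 q) ^+ 2 +
    (q0 p * q3 q - q3 p * q0 q) ^+ 2 + (q1 p * q2 q - q2 p * q1 q) ^+ 2 +
    (q1 p * q3 q - q3 p * q1 q) ^+ 2 + (q2 p * q3 q - q3 p * q2 q) ^+ 2.
    by rewrite /A /B /d /quat_normsq; ring.
  by rewrite !addr_ge0 // sqr_ge0.
have dle : d <= Num.sqrt A * Num.sqrt B.
  rewrite -sqrtrM ?quat_normsq_ge0 //; apply: (le_trans (ler_norm d)).
  by rewrite -sqrtr_sqr ler_wsqrtr.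
rewrite /quat_norm -[leRHS]ger0_norm ?addr_ge0 // -sqrtr_sqr ler_wsqrtr //.
have -> : quat_normsq (p + q) = A + B + d *+ 2 by rewrite /A /B /d /quat_normsq /=; ring.
rewrite sqrrD !sqr_sqrtr ?quat_normsq_ge0 // -/A -/B.
by rewrite [leLHS]addrAC lerD2r lerD2l lerMn2r /= dle.
Qed.
Lemma quat_normZ k q : quat_norm (k *: q) = `|k| * quat_norm q.
Proof.
rewrite /quat_norm.
have -> : quat_normsq (k *: q) = k ^+ 2 * quat_normsq q by rewrite /quat_normsq /=; ring.
by rewrite sqrtrM ?sqr_ge0 // sqrtr_sqr.
Qed.
Lemma quat_norm_eq0 q : quat_norm q = 0 -> q = 0.
Proof.
move/eqP; rewrite sqrtr_eq0 => le0; apply/eqP; rewrite -quat_normsq_eq0.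
by rewrite eq_le le0 quat_normsq_ge0.
Qed.
(* Euclidean norm, and the topology it induces. *)
HB.instance Definition _ := Lmodule_isNormed.Build R (quat R) quat_ler_normD quat_normZ quat_norm_eq0.

End QuatStructures.

Section SliceHyperholomorphic.
Variable R : realType.
Implicit Types (p q I J : quat R) (U : set (quat R)).

Definition quat_im q : quat R := Quat 0 (q1 q) (q2 q) (q3 q).

Definition unit_sphere : set (quat R) := [set I | q0 I = 0 /\ `|I| = 1].

Definition slice_plane I : set (quat R) :=
  [set z | exists x y : R, z = x%:A + y *: I].

Definition sphere_of q : set (quat R) :=
  [set (q0 q)%:A + `|quat_im q| *: I | I in unit_sphere].

Definition axially_symmetric U := forall q, U q -> sphere_of q `<=` U.

Definition profile U : set (R * R) :=
  [set w | forall I, unit_sphere I -> U (w.1%:A + w.2 *: I)].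

Definition du (g : R * R -> quat R) : R * R -> quat R :=
  'D_((1, 0) : R * R) g.
Definition dv (g : R * R -> quat R) : R * R -> quat R :=
  'D_((0, 1) : R * R) g.

Definition C1_on (W : set (R * R)) (g : R * R -> quat R) :=
  [/\ forall w, W w -> derivable g w ((1, 0) : R * R),
      forall w, W w -> derivable g w ((0, 1) : R * R),
      {within W, continuous (du g)} &
      {within W, continuous (dv g)}].

(* f is a total function; only its values on U matter. *)
Definition left_slice_hyperholomorphic U (f : quat R -> quat R) :=
  exists alpha beta : R * R -> quat R,
  [/\ C1_on (profile U) alpha /\ C1_on (profile U) beta,
      forall u v, profile U (u, v) ->
        alpha (u, - v) = alpha (u, v) /\ beta (u, - v) = - beta (u, v),
      forall w, profile U w ->
        du alpha w = dv beta w /\ dv alpha w = - du beta w &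
      forall u v, profile U (u, v) -> forall I, unit_sphere I ->
        f (u%:A + v *: I) = alpha (u, v) + I * beta (u, v)].

Definition e_ (i : 'I_4) : quat R :=
  Quat (i == 0 :> nat)%:R (i == 1 :> nat)%:R (i == 2 :> nat)%:R (i == 3 :> nat)%:R.

Definition laplacian (f : quat R -> quat R) q : quat R :=
  \sum_(i < 4) 'D_(e_ i) ('D_(e_ i) f) q.

(* The outer radius may be +oo. *)
Definition slice_annulus I p (R1 : R) (R2 : \bar R) : set (quat R) :=
  [set z | [/\ slice_plane I z, R1 < `|z - p| & (`|z - p|%:E < R2)%E]].

(* For real p every I is admissible, and all of them give the same set. *)
Definition annular_domain p (R1 : R) (R2 : \bar R) : set (quat R) :=
  [set q | exists I, [/\ unit_sphere I, slice_plane I p &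
    exists J (x y : R), [/\ unit_sphere J,
      slice_annulus I p R1 R2 (x%:A + y *: I),
      slice_annulus I p R1 R2 (x%:A - y *: I) &
      q = x%:A + y *: J]]].

(* (q - p)^{*m} *)
Definition starpow q p (m : nat) : quat R :=
  \sum_(i < m.+1) (q ^+ i * (- p) ^+ (m - i)) *+ 'C(m, i).

(* (q - p)^{*m} * (\bar q - p)^{*k} = (\bar q - p)^{*k} * (q - p)^{*m} *)
Definition starprod q p (m k : nat) : quat R :=
  \sum_(i < m.+1) \sum_(j < k.+1)
    (q ^+ i * quat_conj q ^+ j * (- p) ^+ (m - i + (k - j))) *+ ('C(m, i) * 'C(k, j)).

(* (q - p)^{-*n}, for q outside of the sphere of p *)
Definition starpowN q p (n : nat) : quat R :=
  (q ^+ 2 - (2 * q0 p) *: q + (`|p| ^+ 2)%:A) ^- n * starpow q (quat_conj p) n.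

Definition Qtilde (n : nat) q p : quat R :=
  2 *: \sum_(j < n.+1)
    ((n - j).+1%:R / (n.+1%:R * n.+2%:R)) *: starprod q p (n - j) j.

Definition Mpoly (n : nat) q p : quat R :=
  \sum_(j < n.+1) starprod q p j (n - j) *+ (n - j).

(* Q_{c,p}^{-m}(q) *)
Definition QcN p (m : nat) q : quat R :=
  (p ^+ 2 - (2 * q0 q) *: p + (`|q| ^+ 2)%:A) ^- m.

Definition psum (m : nat) (u : nat -> quat R) (N : nat) : quat R :=
  \sum_(m <= n < N) u n.

Definition abs_unif_cvg (K : set (quat R)) (m : nat)
    (u : nat -> quat R -> quat R) :=
  (forall q, K q -> cvgn (fun N => \sum_(m <= n < N) `|u n q|)) /\
  {uniform K, (fun N q => psum m (u^~ q) N) @ \oo -->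
              (fun q => limn (psum m (u^~ q)))}.

Definition laurent_expansion (D : set (quat R)) (f : quat R -> quat R) p
    (a : int -> quat R) :=
  let pos n q := starpow q p n * a n%:Z in
  let neg n q := starpowN q p n * a (- n%:Z) in
  (forall K, compact K -> K `<=` D ->
     abs_unif_cvg K 0 pos /\ abs_unif_cvg K 1 neg) /\
  (forall q, D q -> f q = limn (psum 0 (pos^~ q)) + limn (psum 1 (neg^~ q))).

Definition limsup_root (u : nat -> quat R) : \bar R :=
  limn_esup (fun n => (`|u n| `^ n%:R^-1)%:E).

End SliceHyperholomorphic.

(* Main.v *)
Require Import Defs.
From mathcomp Require Import all_boot all_order all_algebra ring lra zify.
From mathcomp Require Import all_classical all_reals all_analysis.

Set Implicit Arguments.
Unset Strict Implicit.
Unset Printing Implicit Defensive.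

Import Order.TTheory GRing.Theory Num.Theory.
Import numFieldNormedType.Exports.

Local Open Scope classical_set_scope.
Local Open Scope ring_scope.

(* With A = L_q - R_p and B = L_(conj q) - R_p (left and right multiplications
   commute, so all star products become products of operators), the terms of the
   expansion are A^n 1 * a_n and A^(-n) 1 * a_(-n), and
   starprod q p m k = A^m B^k 1, while A B is right multiplication by the base of
   Q_(c,p). The operator A is normal with extreme singular values the numbers
   |z - p|, z in [q] and in the plane of p, so on the annular domain
   |A| < R2 and |A^(-1)| < 1 / R1.
   Along a line q + t e one has A(t + h) = A(t) + h e, and expanding the powers of
   A(t + h) to second order with a cubic remainder, uniformly in t and summably in
   n, gives the second derivatives term by term:
   2 sum A^i e A^j e A^k. Since sum_e e x e = - 2 conj x, summing over the basis
   turns e A^j e into - 2 B^j. *)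

Local Ltac quat_ring := apply: quat_eq; rewrite /= ?/quat_normsq /=; ring.

(** * Quaternion norm, and the Sylvester operator with its inverse *)

Section QuaternionNorm.
Variable R : realType.
Implicit Types (p q x y : quat R) (k : R).

Lemma quat_sqrnorm x : `|x| ^+ 2 = quat_normsq x.
Proof. by rewrite sqr_sqrtr // quat_normsq_ge0. Qed.

Lemma quat_normM x y : `|x * y| = `|x| * `|y|.
Proof.
apply: (@pexpIrn _ 2) => //; rewrite ?nnegrE ?mulr_ge0 ?normr_ge0 //.
by rewrite exprMn !quat_sqrnorm /quat_normsq /=; ring.
Qed.

Lemma quat_norm1 : `|1 : quat R| = 1.
Proof.
apply: (@pexpIrn _ 2) => //; rewrite ?nnegrE ?normr_ge0 ?ler01 //.
by rewrite quat_sqrnorm /quat_normsq /=; ring.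
Qed.

Lemma quat_norm_e (i : 'I_4) : `|e_ R i| = 1.
Proof.
apply: (@pexpIrn _ 2) => //; rewrite ?nnegrE ?normr_ge0 ?ler01 //.
by rewrite quat_sqrnorm /quat_normsq; case: i => -[|[|[|[|i]]]] //= _; ring.
Qed.

Lemma quat_component_le x :
  [/\ `|q0 x| <= `|x|, `|q1 x| <= `|x|, `|q2 x| <= `|x| & `|q3 x| <= `|x|].
Proof.
split; rewrite -(ler_pXn2r (n := 2)) ?nnegrE ?normr_ge0 //;
  rewrite quat_sqrnorm /quat_normsq real_normK ?num_real // -subr_ge0.
- by rewrite (_ : _ - _ = q1 x ^+ 2 + q2 x ^+ 2 + q3 x ^+ 2);
    [rewrite !addr_ge0 // sqr_ge0|ring].
- by rewrite (_ : _ - _ = q0 x ^+ 2 + q2 x ^+ 2 + q3 x ^+ 2);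
    [rewrite !addr_ge0 // sqr_ge0|ring].
- by rewrite (_ : _ - _ = q0 x ^+ 2 + q1 x ^+ 2 + q3 x ^+ 2);
    [rewrite !addr_ge0 // sqr_ge0|ring].
- by rewrite (_ : _ - _ = q0 x ^+ 2 + q1 x ^+ 2 + q2 x ^+ 2);
    [rewrite !addr_ge0 // sqr_ge0|ring].
Qed.

Lemma quat_norm_le_components x :
  `|x| <= `|q0 x| + `|q1 x| + `|q2 x| + `|q3 x|.
Proof.
have sqn (r : R) : r ^+ 2 = `|r| ^+ 2 by rewrite real_normK ?num_real.
rewrite -(ler_pXn2r (n := 2)) ?nnegrE ?addr_ge0 //.
rewrite quat_sqrnorm /quat_normsq (sqn (q0 x)) (sqn (q1 x)) (sqn (q2 x)) (sqn (q3 x)).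
move: (normr_ge0 (q0 x)) (normr_ge0 (q1 x)) (normr_ge0 (q2 x)) (normr_ge0 (q3 x)).
move: `|_| `|_| `|_| `|_| => a b c d a0 b0 c0 d0.
rewrite -subr_ge0 (_ : _ - _ = 2 * (a * b + a * c + a * d + b * c + b * d + c * d)); last by ring.
by rewrite mulr_ge0 // !addr_ge0 // mulr_ge0.
Qed.

(* The Sylvester operator L_q - R_p. *)
Definition sylv q p y := q * y - y * p.

Lemma sylvD q p x y : sylv q p (x + y) = sylv q p x + sylv q p y.
Proof. by quat_ring. Qed.

Lemma sylvB q p x y : sylv q p (x - y) = sylv q p x - sylv q p y.
Proof. by quat_ring. Qed.

Lemma sylvZ q p k x : sylv q p (k *: x) = k *: sylv q p x.
Proof. by quat_ring. Qed.

Lemma sylv_mulr q p x y : y * p = p * y -> sylv q p (x * y) = sylv q p x * y.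
Proof. by move=> e; rewrite /sylv mulrBl -!mulrA e. Qed.

Lemma sylv_mull q p x y : x * q = q * x -> sylv q p (x * y) = x * sylv q p y.
Proof. by move=> e; rewrite /sylv mulrBr !mulrA e. Qed.

Lemma sylv_comm q q' p p' y : q * q' = q' * q -> p * p' = p' * p ->
  sylv q p (sylv q' p' y) = sylv q' p' (sylv q p y).
Proof.
move=> e e'; rewrite /sylv !mulrBr !mulrBl !opprB !mulrA e -!(mulrA y) e'.
by rewrite [X in _ + X = _]addrC addrACA [X in _ + X = _]addrC.
Qed.

(* Eigenvalue moduli of [sylv q p], the extreme values of |z - p| for z in the
   sphere of q and in the plane of p. *)
Definition outer_radius q p : R :=
  Num.sqrt ((q0 q - q0 p) ^+ 2 + (`|quat_im q| + `|quat_im p|) ^+ 2).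
Definition inner_radius q p : R :=
  Num.sqrt ((q0 q - q0 p) ^+ 2 + (`|quat_im q| - `|quat_im p|) ^+ 2).

Lemma sqr_outer_radius q p : outer_radius q p ^+ 2 =
  (q0 q - q0 p) ^+ 2 + (`|quat_im q| + `|quat_im p|) ^+ 2.
Proof. by rewrite sqr_sqrtr // addr_ge0 ?sqr_ge0. Qed.

Lemma sqr_inner_radius q p : inner_radius q p ^+ 2 =
  (q0 q - q0 p) ^+ 2 + (`|quat_im q| - `|quat_im p|) ^+ 2.
Proof. by rewrite sqr_sqrtr // addr_ge0 ?sqr_ge0. Qed.

(** Left and right multiplications by imaginary quaternions are skew-adjoint, so
    [quat_im q * y - y * quat_im p] is orthogonal to [y], and Pythagoras separates it from the
    scalar part. *)
Lemma sqr_sylv_norm q p y : `|sylv q p y| ^+ 2 =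
  (q0 q - q0 p) ^+ 2 * `|y| ^+ 2 + `|quat_im q * y - y * quat_im p| ^+ 2.
Proof. by rewrite !quat_sqrnorm /quat_normsq /=; ring. Qed.

Lemma sylv_norm_le q p y : `|sylv q p y| <= outer_radius q p * `|y|.
Proof.
rewrite -(ler_pXn2r (n := 2)) ?nnegrE ?mulr_ge0 ?sqrtr_ge0 //.
rewrite sqr_sylv_norm exprMn sqr_outer_radius mulrDl lerD2l -exprMn.
rewrite ler_pXn2r ?nnegrE ?mulr_ge0 ?addr_ge0 //.
by rewrite (le_trans (ler_normB _ _)) // !quat_normM mulrDl lerD2l mulrC.
Qed.

Lemma sylv_norm_ge q p y : inner_radius q p * `|y| <= `|sylv q p y|.
Proof.
rewrite -(ler_pXn2r (n := 2)) ?nnegrE ?mulr_ge0 ?sqrtr_ge0 //.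
rewrite sqr_sylv_norm exprMn sqr_inner_radius mulrDl lerD2l -exprMn.
rewrite -[X in X <= _]real_normK ?num_real // ler_pXn2r ?nnegrE //.
by rewrite mulrBl -quat_normM mulrC -quat_normM ler_dist_dist.
Qed.

(* Base of the powers [QcN p m q]. *)
Definition quadr q p := p ^+ 2 - (2 * q0 q) *: p + (`|q| ^+ 2)%:A.

Lemma quadr_comm q p : quadr q p * p = p * quadr q p.
Proof. by rewrite /quadr quat_sqrnorm !expr2; quat_ring. Qed.

(** In the expansion of A B, left multiplications occur only through q + conj q and q conj q. Both
    are real, which leaves right multiplication by a real quadratic polynomial in p. *)
Lemma sylv_conj q p y : sylv q p (sylv (quat_conj q) p y) = y * quadr q p.
Proof. by rewrite /sylv /quadr quat_sqrnorm expr2; quat_ring. Qed.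

Lemma inner_radius_conj q : inner_radius q (quat_conj q) = 0.
Proof.
rewrite /inner_radius (_ : `|quat_im _| = `|quat_im (quat_conj q)|) /=.
  by rewrite !subrr expr0n /= addr0 sqrtr0.
apply: (@pexpIrn _ 2) => //; rewrite ?nnegrE ?normr_ge0 //.
by rewrite !quat_sqrnorm /quat_normsq /=; ring.
Qed.

Lemma sylv_inj q p x y : 0 < inner_radius q p ->
  sylv q p x = sylv q p y -> x = y.
Proof.
move=> r0 e; apply/eqP; rewrite -subr_eq0 -normr_le0 -(pmulr_rle0 _ r0).
by rewrite (le_trans (sylv_norm_ge _ _ _)) // sylvB e subrr normr0.
Qed.

Lemma quat_conjK : involutive (@quat_conj R).
Proof. by move=> x; apply: quat_eq => //=; rewrite opprK. Qed.

(** If [quadr q p] vanished, A would annihilate B 1 = conj q - p. Injectivity of A then gives p =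
    conj q, where the inner radius is 0. *)
Lemma quadr_neq0 q p : 0 < inner_radius q p -> quadr q p != 0.
Proof.
move=> r0; apply/eqP => P0.
have /(sylv_inj r0) e : sylv q p (sylv (quat_conj q) p 1) = sylv q p 0.
  by rewrite sylv_conj P0 /sylv !mulr0 mul0r subrr.
move: r0; move/eqP: e; rewrite /sylv mulr1 mul1r subr_eq0 => /eqP <-.
by rewrite inner_radius_conj ltxx.
Qed.

(* Inverse of [sylv q p] only when [inner_radius q p] is positive. *)
Definition isylv q p y := sylv (quat_conj q) p y / quadr q p.

Lemma sylvK q p y : 0 < inner_radius q p -> sylv q p (isylv q p y) = y.
Proof.
move=> r0; have u : quadr q p \is a GRing.unit by exact: quadr_neq0.
rewrite /isylv sylv_mulr ?sylv_conj ?mulrK //.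
by apply/esym/commrV/esym/quadr_comm.
Qed.

Lemma isylvK q p y : 0 < inner_radius q p -> isylv q p (sylv q p y) = y.
Proof. by move=> r0; apply: (sylv_inj r0); rewrite sylvK. Qed.

Lemma isylvD q p x y : isylv q p (x + y) = isylv q p x + isylv q p y.
Proof. by rewrite /isylv sylvD mulrDl. Qed.

End QuaternionNorm.

(** * Second derivatives from uniform Taylor expansions *)

Section SecondOrderTaylor.
Variables (R : realType) (W : normedModType R).
Local Notation V := (quat R).

Lemma derive_of_quadratic_error (f : W -> V) (a v : W)
    (l : V) (C e : R) : 0 < e ->
  (forall h, `|h| < e -> `|f (h *: v + a) - f a - h *: l| <= C * `|h| ^+ 2) ->
  'D_v f a = l.
Proof.
move=> e0 H; apply: cvg_lim; first exact: norm_hausdorff.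
apply/cvgrPdist_le => eps eps0.
(* [C] has no sign; [|C| + 1] is a positive bound for it that can be divided by. *)
have C0 : 0 < `|C| + 1 by rewrite ltr_wpDl.
near=> h.
have h0 : h != 0 by near: h; exact: nbhs_dnbhs_neq.
have hs : `|h| < Num.min e (eps / (`|C| + 1)).
  near: h; apply: dnbhs0_lt; rewrite lt_min e0 divr_gt0 //.
move: hs; rewrite lt_min => /andP[he hC].
have -> : l - h^-1 *: (f (h *: v + a) - f a) =
    - (h^-1 *: (f (h *: v + a) - f a - h *: l)).
  by rewrite [in RHS]scalerBr [h^-1 *: (h *: l)]scalerA mulVf // scale1r opprB.
rewrite normrN normrZ normrV ?unitfE // mulrC ler_pdivrMr ?normr_gt0 //.
apply: (le_trans (H _ he)).
rewrite expr2 mulrA ler_wpM2r //.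
move: hC; rewrite ltr_pdivlMr // => hC.
by apply: le_trans (ltW hC); rewrite mulrC ler_wpM2l // (le_trans (ler_norm C)) // lerDl.
Unshelve. all: by end_near. Qed.

(* The constant is uniform in the base point: this is what makes a second-order
   expansion imply twice differentiability. *)
Definition taylor2 (d : R) (g g1 g2 : R -> V) :=
  exists K, forall t h, `|t| < d -> `|t + h| < d ->
    `|g (t + h) - g t - h *: g1 t - h ^+ 2 *: g2 t| <= K * `|h| ^+ 3.

Lemma taylor2D d g g1 g2 k k1 k2 : taylor2 d g g1 g2 -> taylor2 d k k1 k2 ->
  taylor2 d (g \+ k) (g1 \+ k1) (g2 \+ k2).
Proof.
move=> [K HK] [L HL]; exists (K + L) => t h td thd /=.
rewrite mulrDl (le_trans _ (lerD (HK _ _ td thd) (HL _ _ td thd))) //.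
apply: le_trans (ler_normD _ _); rewrite le_eqVlt; apply/orP; left; apply/eqP.
congr `|_|.
move: (g _) (g _) (k _) (k _) (g1 _) (k1 _) (g2 _) (k2 _) => a b a' b' c c' e e'.
by quat_ring.
Qed.

Lemma taylor2_derive1 d g g1 g2 (f : W -> V) (x v : W) t :
  taylor2 d g g1 g2 -> (forall s, `|s| < d -> f (s *: v + x) = g s) ->
  `|t| < d -> 'D_v f (t *: v + x) = g1 t.
Proof.
move=> [K HK] fg td.
(* The first bound keeps [t + h] in range; the second gives [|h|^3 <= |h|^2]. *)
pose e := Num.min (d - `|t|) 1.
apply: (@derive_of_quadratic_error _ _ _ _ (`|g2 t| + `|K|) e).
  by rewrite /e lt_min subr_gt0 td ltr01.
move=> h; rewrite /e lt_min => /andP[hd h1].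
have thd : `|t + h| < d by rewrite (le_lt_trans (ler_normD _ _)) // -ltrBrDl.
rewrite addrA -scalerDl [h + t]addrC !fg //.
have -> : g (t + h) - g t - h *: g1 t =
    h ^+ 2 *: g2 t + (g (t + h) - g t - h *: g1 t - h ^+ 2 *: g2 t).
  by rewrite [RHS]addrC subrK.
rewrite (le_trans (ler_normD _ _)) // [leRHS]mulrDl lerD //.
  by rewrite normrZ normrX mulrC.
apply: (le_trans (HK _ _ td thd)).
apply: (@le_trans _ _ (`|K| * `|h| ^+ 3)); first by rewrite ler_wpM2r ?exprn_ge0 ?ler_norm.
rewrite ler_wpM2l // exprS -[leRHS]mul1r ler_wpM2r ?exprn_ge0 //.
exact: ltW.
Qed.

(** Compare the expansions from 0 to 2h, from h to 2h and from h to 0: the values of [g] and the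
    term [g2 h] cancel, leaving 2h (g1 h - g1 0 - 2h g2 0). *)
Lemma taylor2_derive2 d g g1 g2 (f : W -> V) (x v : W) :
  0 < d -> taylor2 d g g1 g2 ->
  (forall s, `|s| < d -> f (s *: v + x) = g s) ->
  'D_v ('D_v f) x = 2 *: g2 0.
Proof.
move=> d0 T fg.
have D1 t : `|t| < d -> 'D_v f (t *: v + x) = g1 t by exact: taylor2_derive1 T fg.
case: T => K HK.
(* The three errors are 8K, K and K times |h|^3, and division by 2|h| gives 5K |h|^2. The radius
   [d / 2] keeps 2h in range. *)
apply: (@derive_of_quadratic_error _ _ _ _ (5 * K) (d / 2)).
  by rewrite divr_gt0.
move=> h hd.
have hd1 : `|h| < d by rewrite (lt_trans hd) // ltr_pdivrMr // mulr_natr mulr2n ltrDl.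
have z0 : `|0 : R| < d by rewrite normr0.
have h2d : `|h + h| < d.
  rewrite (le_lt_trans (ler_normD _ _)) //; move: hd.
  by rewrite ltr_pdivlMr // mulr_natr mulr2n.
rewrite D1 // -[x in 'D_v f x]add0r -(scale0r v) D1 //.
have [->|hn0] := eqVneq h 0; first by rewrite subrr !scale0r subrr !normr0 expr0n /= mulr0.
have E1 := HK 0 (h + h) z0; rewrite add0r in E1; have {}E1 := E1 h2d.
have E2 := HK h h hd1 h2d.
have E3 := HK h (- h) hd1; rewrite subrr in E3; have {}E3 := E3 z0.
have h0 : 0 < `|h + h|.
  by rewrite -mulr2n normrMn pmulrn_lgt0 // normr_gt0.
rewrite -(ler_pM2l h0) -normrZ.
set X := (h + h) *: _.
have -> : X = (g (h + h) - g 0 - (h + h) *: g1 0 - (h + h) ^+ 2 *: g2 0)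
    - ((g (h + h) - g h - h *: g1 h - h ^+ 2 *: g2 h)
       - (g 0 - g h - (- h) *: g1 h - (- h) ^+ 2 *: g2 h)).
  rewrite /X; move: (g _) (g _) (g _) (g1 _) (g1 _) (g2 _) (g2 _).
  by move=> a b c a' b' c' d'; quat_ring.
have := ler_normB (g (h + h) - g 0 - (h + h) *: g1 0 - (h + h) ^+ 2 *: g2 0)
  ((g (h + h) - g h - h *: g1 h - h ^+ 2 *: g2 h)
       - (g 0 - g h - (- h) *: g1 h - (- h) ^+ 2 *: g2 h)).
move/le_trans; apply.
rewrite (le_trans (lerD E1 (le_trans (ler_normB _ _) (lerD E2 E3)))) //.
rewrite normrN -mulr2n normrMn le_eqVlt; apply/orP; left; apply/eqP; ring.
Qed.

End SecondOrderTaylor.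

(** * Dominated convergence of quaternion series *)

Section QuaternionSeries.
Variable R : realType.
Local Notation V := (quat R).

Lemma quat_cvg_components (u : nat -> V) (l : V) :
  q0 (u n) @[n --> \oo] --> q0 l -> q1 (u n) @[n --> \oo] --> q1 l ->
  q2 (u n) @[n --> \oo] --> q2 l -> q3 (u n) @[n --> \oo] --> q3 l ->
  u n @[n --> \oo] --> l.
Proof.
move=> /cvgrPdist_le c0 /cvgrPdist_le c1 /cvgrPdist_le c2 /cvgrPdist_le c3.
apply/cvgrPdist_le => e e0.
have e4 : 0 < e / 4 by rewrite divr_gt0.
near=> n; rewrite (le_trans (quat_norm_le_components _)) //.
have -> : e = e / 4 + e / 4 + e / 4 + e / 4 by field.
by rewrite !lerD //; near: n; [exact: c0|exact: c1|exact: c2|exact: c3].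
Unshelve. all: by end_near. Qed.

(** Each component is dominated by the norm, so the real comparison test applies four times and the
    limit is assembled from the components. *)
Lemma quat_series_dominated (u : nat -> V) (M : nat -> R) :
  (forall n, `|u n| <= M n) -> cvgn (series M) -> cvgn (series u).
Proof.
move=> uM cM.
have comp (f : V -> R) : (forall x, `|f x| <= `|x|) -> {morph f : x y / x + y} ->
    f 0 = 0 -> cvgn (fun N => f (series u N)).
  move=> fle fD f0.
  have -> : (fun N => f (series u N)) = series (f \o u).
    by apply/funext => N; rewrite /series /= (big_morph f fD f0).
  apply: normed_cvg; apply: series_le_cvg cM => n //=.
    by rewrite (le_trans (normr_ge0 (u n))).
  by rewrite (le_trans (fle _)).
have [c0 c1 c2 c3] : [/\ cvgn (fun N => q0 (series u N)),
    cvgn (fun N => q1 (series u N)), cvgn (fun N => q2 (series u N)) &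
    cvgn (fun N => q3 (series u N))].
  by split; apply: comp => // x; case: (quat_component_le x).
apply/cvg_ex; exists (Quat (limn (fun N => q0 (series u N)))
  (limn (fun N => q1 (series u N))) (limn (fun N => q2 (series u N)))
  (limn (fun N => q3 (series u N)))).
exact: quat_cvg_components.
Qed.

Lemma psum_dominated m (u : nat -> V) (M : nat -> R) :
  (forall n, `|u n| <= M n) -> cvgn (series M) -> cvgn (psum m u).
Proof.
by move=> uM cM; rewrite is_cvg_series_restrict; exact: quat_series_dominated cM.
Qed.

Lemma psum_limn_norm m (u : nat -> V) (M : nat -> R) :
  (forall n, `|u n| <= M n) -> cvgn (series M) ->
  `|limn (psum m u)| <= limn (series M).
Proof.
move=> uM cM; have cu := psum_dominated (m := m) uM cM.
rewrite -lim_norm // (ler_lim (is_cvg_norm cu) cM) //.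
near=> N.
have mN : (m <= N)%N by near: N; exact: nbhs_infty_ge.
rewrite /series /= (@big_cat_nat _ _ _ m 0 N) //= (le_trans (ler_norm_sum _ _ _)) //.
rewrite -[leLHS]add0r lerD ?ler_sum // sumr_ge0 // => i _.
by rewrite (le_trans (normr_ge0 (u i))).
Unshelve. all: by end_near. Qed.

(** Partial sums of the remainders are remainders of the partial sums. Passing to the limit bounds
    the remainder by |h|^3 times the sum of [M], which is the constant [K] of [taylor2]. *)
Lemma taylor2_psum m d (u u1 u2 : nat -> R -> V) (M : nat -> R) :
  cvgn (series M) ->
  (forall n t, `|t| < d -> [/\ `|u n t| <= M n, `|u1 n t| <= M n & `|u2 n t| <= M n]) ->
  (forall n t h, `|t| < d -> `|t + h| < d ->
    `|u n (t + h) - u n t - h *: u1 n t - h ^+ 2 *: u2 n t| <= `|h| ^+ 3 * M n) ->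
  taylor2 d (fun t => limn (psum m (u^~ t))) (fun t => limn (psum m (u1^~ t)))
    (fun t => limn (psum m (u2^~ t))).
Proof.
move=> cM bd rem; exists (limn (series M)) => t h td thd.
have cv (w : nat -> R -> V) s : (forall n, `|w n s| <= M n) ->
  psum m (w^~ s) @ \oo --> limn (psum m (w^~ s)).
  by move=> wM; exact: psum_dominated wM cM.
have c0 : psum m (u^~ t) @ \oo --> limn (psum m (u^~ t)) by apply: cv => n; case: (bd n t).
have c0' : psum m (u^~ (t + h)) @ \oo --> limn (psum m (u^~ (t + h))).
  by apply: cv => n; case: (bd n (t + h)).
have c1 : psum m (u1^~ t) @ \oo --> limn (psum m (u1^~ t)) by apply: cv => n; case: (bd n t).
have c2 : psum m (u2^~ t) @ \oo --> limn (psum m (u2^~ t)) by apply: cv => n; case: (bd n t).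
pose r n := u n (t + h) - u n t - h *: u1 n t - h ^+ 2 *: u2 n t.
have cr : psum m r @ \oo --> limn (psum m (u^~ (t + h))) - limn (psum m (u^~ t))
    - h *: limn (psum m (u1^~ t)) - h ^+ 2 *: limn (psum m (u2^~ t)).
  rewrite (_ : psum m r = fun N => psum m (u^~ (t + h)) N - psum m (u^~ t) N
      - h *: psum m (u1^~ t) N - h ^+ 2 *: psum m (u2^~ t) N).
    exact: cvgB (cvgB (cvgB c0' c0) (cvgZl_tmp c1)) (cvgZl_tmp c2).
  by apply/funext => N; rewrite /psum /r !sumrB -!scaler_sumr.
rewrite -(cvg_lim _ cr) //.
rewrite mulrC -[_ * _]/(_ *: _ : R^o) -lim_seriesZ //.
by apply: psum_limn_norm; [move=> n; exact: rem|exact: is_cvg_seriesZ].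
Qed.

End QuaternionSeries.

(** * Summability from the limsup of the roots *)

Section PowerSeriesBounds.
Variable R : realType.

Lemma is_cvg_series_poly_geometric (x : R) : 0 <= x < 1 ->
  cvgn (series (fun n => n.+1%:R ^+ 3 * x ^+ n)).
Proof.
move=> /andP[x0 x1].
(* With x = s^4, three factors s^n absorb the cube of [n.+1] and the fourth leaves a geometric
   series. *)
pose s := Num.sqrt (Num.sqrt x).
have s0 : 0 <= s by exact: sqrtr_ge0.
have xs : x = s ^+ 4.
  by rewrite (exprM s 2 2) sqr_sqrtr ?sqrtr_ge0 // sqr_sqrtr.
have s1 : s < 1.
  by rewrite ltNge; apply/negP => s1; move: x1; rewrite xs ltNge exprn_ege1.
have s1' : 0 < 1 - s by rewrite subr_gt0.
(* Each of the n + 1 terms of 1 + s + ... + s^n is at least s^n. *)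
have bd n : n.+1%:R * s ^+ n <= (1 - s)^-1.
  rewrite -[leRHS]mul1r ler_pdivlMr // (@le_trans _ _ (1 - s ^+ n.+1)) //; last first.
    by rewrite lerBlDr lerDl exprn_ge0.
  rewrite -(expr1n _ n.+1) subrXX mulrC expr1n ler_wpM2l ?(ltW s1') //.
  rewrite mulr_natl -[n.+1 in X in X <= _]card_ord -sumr_const ler_sum // => i _.
  rewrite expr1n mul1r (@ler_wiXn2l _ s) ?(ltW s1) //.
  by rewrite -ltnS ltn_ord.
apply: (@series_le_cvg _ _ (geometric ((1 - s) ^- 3) s)).
- by move=> n; rewrite mulr_ge0 ?exprn_ge0.
- by move=> n; rewrite geometric_ge0 // invr_ge0 exprn_ge0 // ltW.
- move=> n; rewrite /geometric /= xs -exprM mulSn addnC exprD mulrA ler_wpM2r ?exprn_ge0 //.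
  rewrite mulnC exprM -exprMn -exprVn lerXn2r ?nnegrE ?mulr_ge0 ?exprn_ge0 //.
  by rewrite invr_ge0 ltW.
by apply: is_cvg_geometric_series; rewrite ger0_norm.
Qed.

Lemma limsup_root_lt (u : nat -> quat R) (l : R) : 0 < l ->
  (limsup_root u < l%:E)%E ->
  exists2 C, 0 <= C & forall n, `|u n| <= C * l ^+ n.
Proof.
move=> l0 /ereal_inf_lt[_ [A [N _ NA] <-] supl].
(* The strict inequality excludes n = 0, where [n%:R^-1] is 0 and the root carries no
   information. *)
have ev n : (N < n)%N -> `|u n| <= l ^+ n.
  move=> Nn; have n0 : (0 < n)%N by case: n Nn.
  have : ((`|u n| `^ n%:R^-1)%:E < l%:E)%E.
    apply: le_lt_trans supl; apply: ereal_sup_ubound; exists n => //.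
    by apply: NA; exact: ltnW.
  rewrite lte_fin => /ltW h.
  have -> : `|u n| = (`|u n| `^ n%:R^-1) ^+ n.
    by rewrite -powR_mulrn ?powR_ge0 // -powRrM mulVf ?pnatr_eq0 -?lt0n // powRr1.
  by rewrite lerXn2r ?nnegrE ?powR_ge0 // ltW.
have term_ge0 i : 0 <= `|u i| / l ^+ i by rewrite divr_ge0 // exprn_ge0 // ltW.
(* The 1 serves the indices beyond [N]; the sum absorbs the finitely many others. *)
exists (1 + \sum_(i < N.+1) `|u i| / l ^+ i).
  by rewrite addr_ge0 // sumr_ge0.
move=> n; have [nN|Nn] := leqP n N; last first.
  by rewrite (le_trans (ev _ Nn)) // ler_peMl ?exprn_ge0 ?(ltW l0) // lerDl sumr_ge0.
rewrite -ler_pdivrMr ?exprn_gt0 // (bigD1 (Ordinal (nN : (n < N.+1)%N))) //=.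
by rewrite addrCA lerDl addr_ge0 // sumr_ge0.
Qed.

(** The cubic weight is the growth in n of the second-order Taylor remainder of an n-th power. *)
Lemma is_cvg_series_limsup_root (u : nat -> quat R) (r l : R) : 0 <= r -> 0 < l -> r * l < 1 ->
  (limsup_root u < l%:E)%E ->
  cvgn (series (fun n => n.+1%:R ^+ 3 * r ^+ n * `|u n|)).
Proof.
move=> r0 l0 rl /(limsup_root_lt l0)[C C0 uC].
apply: (@series_le_cvg _ _ (C *: (fun n : nat => n.+1%:R ^+ 3 * (r * l) ^+ n))) => [n|n|n|].
- by rewrite !mulr_ge0 ?exprn_ge0.
- by rewrite /= !mulr_ge0 ?exprn_ge0 ?mulr_ge0 // ltW.
- rewrite [leRHS](_ : _ = C * (n.+1%:R ^+ 3 * (r * l) ^+ n)) //.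
  rewrite [leRHS](_ : _ = n.+1%:R ^+ 3 * r ^+ n * (C * l ^+ n)); last by rewrite exprMn; ring.
  by rewrite ler_wpM2l ?uC // mulr_ge0 ?exprn_ge0.
by apply/is_cvg_seriesZ/is_cvg_series_poly_geometric; rewrite mulr_ge0 // ltW.
Qed.

End PowerSeriesBounds.

(** * Second-order expansions of positive and negative powers *)

Section PowerExpansions.
Variable R : realType.
Implicit Types (p q e y : quat R) (k h : R).

Definition spow q p n := iter n (sylv q p) 1.
Definition ipow q p n := iter n (isylv q p) 1.

(* Coefficients of h and h^2 in [spow (q + h *: e) p n]. *)
Fixpoint spow1 q p e n :=
  if n is m.+1 then sylv q p (spow1 q p e m) + e * spow q p m else 0.
Fixpoint spow2 q p e n :=
  if n is m.+1 then sylv q p (spow2 q p e m) + e * spow1 q p e m else 0.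

(* Coefficients of h and h^2 in [ipow (q + h *: e) p n]. *)
Fixpoint ipow1 q p e n :=
  if n is m.+1 then isylv q p (ipow1 q p e m - e * ipow q p m.+1) else 0.
Fixpoint ipow2 q p e n :=
  if n is m.+1 then isylv q p (ipow2 q p e m - e * ipow1 q p e m.+1) else 0.

(** For r > 0, division by [r ^+ n] turns the recurrence into n increments, each at most
    [K * n%:R ^+ m]. Thus every further order in h costs one factor n. *)
Lemma recurrence_bound (x : nat -> R) r K m : 0 <= r -> 0 <= K -> x 0 <= 0 ->
  (forall n, x n.+1 <= r * x n + K * n.+1%:R ^+ m * r ^+ n.+1) ->
  forall n, x n <= K * n%:R ^+ m.+1 * r ^+ n.
Proof.
move=> r0 K0 x0 xS; elim=> [|n IH]; first by rewrite expr0n /= mulr0 mul0r.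
apply: (le_trans (xS n)).
apply: (@le_trans _ _ (r * (K * n%:R ^+ m.+1 * r ^+ n) + K * n.+1%:R ^+ m * r ^+ n.+1)).
  by rewrite lerD2r ler_wpM2l.
rewrite mulrCA -exprS -mulrDl ler_wpM2r ?exprn_ge0 // -mulrDr ler_wpM2l //.
rewrite -natr1 [leRHS]exprS mulrDl mul1r lerD2r exprS ler_wpM2l //.
by rewrite lerXn2r ?nnegrE ?addr_ge0 // lerDl.
Qed.

Section PositivePowers.
Variables (p e q : quat R) (r h : R).
Hypothesis r0 : 0 < r.
Hypothesis e1 : `|e| = 1.
Hypothesis Aq : forall y, `|sylv q p y| <= r * `|y|.

Lemma spow_norm n : `|spow q p n| <= r ^+ n.
Proof.
elim: n => [|n IH]; first by rewrite /= quat_norm1 expr0.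
by rewrite exprS (le_trans (Aq _)) // ler_wpM2l // ltW.
Qed.

(** A sum of n words A^i e A^j with i + j = n - 1: one factor [r] is missing, hence [r^-1]. *)
Lemma spow1_norm n : `|spow1 q p e n| <= r^-1 * n%:R * r ^+ n.
Proof.
move: n; apply: (@recurrence_bound (fun n => `|spow1 q p e n|) _ _ 0).
- exact: ltW.
- by rewrite invr_ge0 ltW.
- by rewrite normr0.
- move=> n /=; rewrite (le_trans (ler_normD _ _)) // lerD ?Aq //.
  by rewrite quat_normM e1 mul1r expr0 mulr1 exprS mulKf ?gt_eqF // spow_norm.
Qed.

Lemma spow2_norm n : `|spow2 q p e n| <= r^-1 ^+ 2 * n%:R ^+ 2 * r ^+ n.
Proof.
move: n; apply: (@recurrence_bound (fun n => `|spow2 q p e n|) _ _ 1).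
- exact: ltW.
- by rewrite exprn_ge0 // invr_ge0 ltW.
- by rewrite normr0.
- move=> n /=; rewrite (le_trans (ler_normD _ _)) // lerD ?Aq //.
  rewrite quat_normM e1 mul1r (le_trans (spow1_norm n)) //.
  rewrite [leRHS](_ : _ = r^-1 * n.+1%:R * r ^+ n); last first.
    by rewrite (exprS r n); field; rewrite gt_eqF.
  rewrite ler_wpM2r ?exprn_ge0 ?(ltW r0) // ler_wpM2l ?invr_ge0 ?(ltW r0) //.
  by rewrite ler_nat.
Qed.

Hypothesis Aqh : forall y, `|sylv (q + h *: e) p y| <= r * `|y|.

Lemma spow_taylor_norm n :
  `|spow (q + h *: e) p n - spow q p n - h *: spow1 q p e n - h ^+ 2 *: spow2 q p e n|
  <= `|h| ^+ 3 * r^-1 ^+ 3 * n%:R ^+ 3 * r ^+ n.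
Proof.
pose rem n := spow (q + h *: e) p n - spow q p n - h *: spow1 q p e n - h ^+ 2 *: spow2 q p e n.
move: n; apply: (@recurrence_bound (fun n => `|rem n|) _ _ 2).
- exact: ltW.
- by rewrite mulr_ge0 ?exprn_ge0 // invr_ge0 ltW.
- by rewrite /rem /= !scaler0 !subr0 subrr normr0.
move=> n.
(* All orders below h^3 cancel, so the remainder obeys the recurrence of the perturbed operator with
   a purely cubic source. *)
have -> : rem n.+1 = sylv (q + h *: e) p (rem n) + h ^+ 3 *: (e * spow2 q p e n).
  rewrite /rem /=; move: (spow _ _ _) (spow _ _ _) (spow1 _ _ _ _) (spow2 _ _ _ _).
  by move=> a b c d; rewrite /sylv; quat_ring.
rewrite (le_trans (ler_normD _ _)) // lerD ?Aqh //.
rewrite normrZ quat_normM e1 mul1r normrX.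
rewrite [leRHS](_ : _ = `|h| ^+ 3 * (r^-1 ^+ 2 * n.+1%:R ^+ 2 * r ^+ n)); last first.
  by rewrite (exprS r n); field; rewrite gt_eqF.
rewrite ler_wpM2l ?exprn_ge0 // (le_trans (spow2_norm n)) //.
rewrite ler_wpM2r ?exprn_ge0 ?(ltW r0) // ler_wpM2l ?exprn_ge0 ?invr_ge0 ?(ltW r0) //.
by rewrite lerXn2r ?nnegrE // ler_nat.
Qed.

End PositivePowers.

Section NegativePowers.
Variables (p e q : quat R) (r h : R).
Hypothesis r0 : 0 <= r.
Hypothesis e1 : `|e| = 1.
Hypothesis qp : 0 < inner_radius q p.
Hypothesis Aq : forall y, `|y| <= r * `|sylv q p y|.

Lemma isylv_norm y : `|isylv q p y| <= r * `|y|.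
Proof. by rewrite (le_trans (Aq _)) // sylvK. Qed.

Lemma ipow_norm n : `|ipow q p n| <= r ^+ n.
Proof.
elim: n => [|n IH]; first by rewrite /= quat_norm1 expr0.
by rewrite exprS (le_trans (isylv_norm _)) // ler_wpM2l.
Qed.

(** The variation of A^(-1) is - A^(-1) e A^(-1), so each e brings one more inverse, whence an
    additional factor [r], the bound of A^(-1). *)
Lemma ipow1_norm n : `|ipow1 q p e n| <= r * n%:R * r ^+ n.
Proof.
move: n; apply: (@recurrence_bound (fun n => `|ipow1 q p e n|) _ _ 0) => //.
  by rewrite normr0.
move=> n; rewrite (le_trans (isylv_norm _)) // expr0 mulr1 -mulrDr ler_wpM2l //.
by rewrite (le_trans (ler_normB _ _)) // lerD2l quat_normM e1 mul1r ipow_norm.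
Qed.

Lemma ipow2_norm n : `|ipow2 q p e n| <= r ^+ 2 * n%:R ^+ 2 * r ^+ n.
Proof.
move: n; apply: (@recurrence_bound (fun n => `|ipow2 q p e n|) _ _ 1) => //.
- by rewrite exprn_ge0.
- by rewrite normr0.
move=> n; rewrite (le_trans (isylv_norm _)) //.
rewrite expr1 (_ : r ^+ 2 * _ * _ = r * (r * n.+1%:R * r ^+ n.+1)); last by ring.
rewrite -mulrDr ler_wpM2l //.
rewrite (le_trans (ler_normB _ _)) // lerD2l quat_normM e1 mul1r.
exact: ipow1_norm.
Qed.

Hypothesis qhp : 0 < inner_radius (q + h *: e) p.
Hypothesis Aqh : forall y, `|y| <= r * `|sylv (q + h *: e) p y|.

Lemma ipow_taylor_norm n :
  `|ipow (q + h *: e) p n - ipow q p n - h *: ipow1 q p e n - h ^+ 2 *: ipow2 q p e n|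
  <= `|h| ^+ 3 * r ^+ 3 * n%:R ^+ 3 * r ^+ n.
Proof.
pose rem n := ipow (q + h *: e) p n - ipow q p n - h *: ipow1 q p e n - h ^+ 2 *: ipow2 q p e n.
move: n; apply: (@recurrence_bound (fun n => `|rem n|) _ _ 2) => //.
- by rewrite mulr_ge0 ?exprn_ge0.
- by rewrite /rem /= !scaler0 !subr0 subrr normr0.
(* Applying the perturbed operator to the remainder makes the recurrence polynomial in h; E0 to E3
   below express level n through level n + 1 for that purpose. *)
move=> n; apply: (le_trans (Aqh _)).
have -> : sylv (q + h *: e) p (rem n.+1) = rem n - h ^+ 3 *: (e * ipow2 q p e n.+1).
  have E0 : ipow (q + h *: e) p n = sylv (q + h *: e) p (ipow (q + h *: e) p n.+1).
    by rewrite [ipow _ _ n.+1]iterS sylvK.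
  have E1 : ipow q p n = sylv q p (ipow q p n.+1) by rewrite [ipow _ _ n.+1]iterS sylvK.
  have E2 : ipow1 q p e n = sylv q p (ipow1 q p e n.+1) + e * ipow q p n.+1.
    by rewrite [in RHS]/ipow1 -/(ipow1 q p e n) sylvK // subrK.
  have E3 : ipow2 q p e n = sylv q p (ipow2 q p e n.+1) + e * ipow1 q p e n.+1.
    by rewrite [ipow2 _ _ _ n.+1]/= sylvK // subrK.
  rewrite /rem E0 E1 E2 E3.
  move: (ipow _ _ _) (ipow _ _ _) (ipow1 _ _ _ _) (ipow2 _ _ _ _).
  by move=> a b c d; rewrite /sylv; quat_ring.
rewrite [r ^+ 3]exprS (_ : _ * (r * r ^+ 2) * _ * _ =
  r * (`|h| ^+ 3 * (r ^+ 2 * n.+1%:R ^+ 2 * r ^+ n.+1))); last by ring.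
rewrite -mulrDr ler_wpM2l // (le_trans (ler_normB _ _)) // lerD2l.
by rewrite normrZ quat_normM e1 mul1r normrX ler_wpM2l ?exprn_ge0 ?ipow2_norm.
Qed.

End NegativePowers.

End PowerExpansions.

(** * Termwise Taylor expansion of power series *)

Section PowerSeriesTaylor.
Variable R : realType.

Lemma taylor2_power_series m d (u u1 u2 : nat -> R -> quat R) (a : nat -> quat R) r k :
  0 <= r -> 0 <= k ->
  cvgn (series (fun n => n.+1%:R ^+ 3 * r ^+ n * `|a n|)) ->
  (forall n t, `|t| < d -> [/\ `|u n t| <= r ^+ n, `|u1 n t| <= k * n%:R * r ^+ n &
     `|u2 n t| <= k ^+ 2 * n%:R ^+ 2 * r ^+ n]) ->
  (forall n t h, `|t| < d -> `|t + h| < d ->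
    `|u n (t + h) - u n t - h *: u1 n t - h ^+ 2 *: u2 n t| <=
      `|h| ^+ 3 * k ^+ 3 * n%:R ^+ 3 * r ^+ n) ->
  [/\ taylor2 d (fun t => limn (psum m (fun n => u n t * a n)))
        (fun t => limn (psum m (fun n => u1 n t * a n)))
        (fun t => limn (psum m (fun n => u2 n t * a n))) &
      forall t, `|t| < d -> cvgn (psum m (fun n => u2 n t * a n))].
Proof.
move=> r0 k0 cv bd rem.
(* A single majorant for all orders: (1 + k)^3 dominates k^i, and the cube of [n.+1] dominates n^i,
   for i <= 3. *)
pose M n := (1 + k) ^+ 3 * (n.+1%:R ^+ 3 * r ^+ n * `|a n|).
have cM : cvgn (series M) by apply: (is_cvg_seriesZ (k := (1 + k) ^+ 3) cv).
have k1 : 1 <= 1 + k by rewrite lerDl.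
have dom (i n : nat) (x : quat R) : (i <= 3)%N ->
    `|x| <= k ^+ i * n%:R ^+ i * r ^+ n -> `|x * a n| <= M n.
  move=> i3 /le_trans xle; rewrite quat_normM.
  have -> : M n = (1 + k) ^+ 3 * n.+1%:R ^+ 3 * r ^+ n * `|a n| by rewrite /M; ring.
  rewrite ler_wpM2r // xle //.
  rewrite ler_wpM2r ?exprn_ge0 // ler_pM ?exprn_ge0 //.
    apply: (@le_trans _ _ ((1 + k) ^+ i)); last exact: (ler_weXn2l k1 i3).
    by rewrite lerXn2r ?nnegrE ?addr_ge0 // lerDr.
  apply: (@le_trans _ _ (n.+1%:R ^+ i)); last by apply: (ler_weXn2l _ i3); rewrite ler1n.
  by rewrite lerXn2r ?nnegrE // ler_nat.
have bds n t : `|t| < d -> [/\ `|u n t * a n| <= M n, `|u1 n t * a n| <= M n &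
    `|u2 n t * a n| <= M n].
  move=> td; have [b0 b1 b2] := bd n t td.
  by split; [apply: (dom 0)|apply: (dom 1)|apply: (dom 2)];
    rewrite // ?expr0 ?expr1 ?mul1r.
split; last first.
  by move=> t td; apply: psum_dominated cM => n; case: (bds n t td).
apply: (@taylor2_psum _ m d (fun n t => u n t * a n) (fun n t => u1 n t * a n)
  (fun n t => u2 n t * a n) M) => //.
move=> n t h td thd.
rewrite !scalerAl -!mulrBl quat_normM.
apply: le_trans (ler_wpM2r (normr_ge0 _) (rem n t h td thd)) _.
rewrite [leLHS](_ : _ = `|h| ^+ 3 * (k ^+ 3 * n%:R ^+ 3 * r ^+ n * `|a n|)); last by ring.
have -> : M n = (1 + k) ^+ 3 * n.+1%:R ^+ 3 * r ^+ n * `|a n| by rewrite /M; ring.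
rewrite ler_wpM2l ?exprn_ge0 // ler_wpM2r // ler_wpM2r ?exprn_ge0 //.
by rewrite ler_pM ?exprn_ge0 // lerXn2r ?nnegrE ?addr_ge0 ?ler_nat // lerDr.
Qed.

End PowerSeriesTaylor.

(** * Sums over the basis, and the star powers as operator powers *)

Section LaplacianOfPowers.
Variable R : realType.
Implicit Types (p q x y s : quat R).

(** Discrete Duhamel formula: each source [y] is propagated by the remaining iterations. *)
Lemma iter_unroll (V : zmodType) (f : V -> V) (x y : nat -> V) :
  {morph f : u v / u + v} -> x 0 = 0 -> (forall n, x n.+1 = f (x n) + y n) ->
  forall n, x n = \sum_(k < n) iter k f (y (n - k.+1)%N).
Proof.
move=> fD x0 xS; have f0 : f 0 = 0 by apply: (addrI (f 0)); rewrite -fD !addr0.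
elim=> [|n IH]; first by rewrite big_ord0.
rewrite big_ord_recl /= subn1 xS addrC; congr (_ + _).
by rewrite IH (big_morph f fD f0).
Qed.

Lemma sum_triangle (V : zmodType) (F : nat -> V) n :
  \sum_(l < n) \sum_(k < n - l) F k = \sum_(k < n) F k *+ (n - k).
Proof.
elim: n => [|n IH]; first by rewrite !big_ord0.
rewrite big_ord_recl subn0 /= IH [in RHS]big_ord_recr /= subSnn mulr1n.
rewrite big_ord_recr /= addrAC -big_split /=; congr (_ + _).
by apply: eq_bigr => k _; rewrite -mulrS subSn // ltnW.
Qed.

Lemma iter_sylvD q p k : {morph iter k (sylv q p) : x y / x + y}.
Proof. by elim: k => [//|k IH] x y; rewrite /= IH sylvD. Qed.

Lemma iter_sylvB q p k : {morph iter k (sylv q p) : x y / x - y}.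
Proof. by elim: k => [//|k IH] x y; rewrite /= IH sylvB. Qed.

Lemma iter_sylvZ q p k c x : iter k (sylv q p) (c *: x) = c *: iter k (sylv q p) x.
Proof. by elim: k => //= k ->; rewrite sylvZ. Qed.

Lemma iter_sylv_sum q p k n (F : 'I_n -> quat R) :
  iter k (sylv q p) (\sum_i F i) = \sum_i iter k (sylv q p) (F i).
Proof.
have f0 := iter_sylvZ q p k 0 0; rewrite !scale0r in f0.
exact: (big_morph _ (@iter_sylvD q p k) f0).
Qed.

Lemma iter_sylv_mulr q p k x s : s * p = p * s ->
  iter k (sylv q p) (x * s) = iter k (sylv q p) x * s.
Proof. by move=> e; elim: k => //= k ->; rewrite sylv_mulr. Qed.

Lemma iter_sylv_mull q p k x s : s * q = q * s ->
  iter k (sylv q p) (s * x) = s * iter k (sylv q p) x.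
Proof. by move=> e; elim: k => //= k ->; rewrite sylv_mull. Qed.

Lemma conj_comm q : q * quat_conj q = quat_conj q * q.
Proof. by quat_ring. Qed.

Lemma iter_sylv_conj_comm q p k l x :
  iter k (sylv q p) (iter l (sylv (quat_conj q) p) x) =
  iter l (sylv (quat_conj q) p) (iter k (sylv q p) x).
Proof.
have c1 y : iter k (sylv q p) (sylv (quat_conj q) p y) =
    sylv (quat_conj q) p (iter k (sylv q p) y).
  by elim: k => //= k ->; rewrite sylv_comm // conj_comm.
by elim: l => //= l <-.
Qed.

Lemma sum_e_mul x y : \sum_(i < 4) e_ R i * (x * (e_ R i * y)) = - 2 *: (quat_conj x * y).
Proof. by rewrite !big_ord_recl big_ord0; case: x y => [????] [????]; quat_ring. Qed.

(** The factor [x] makes the induction close: the outermost A moves q into [x] and p out to the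
    right. Since conj (x q) = conj q conj x, the two pieces recombine into B. *)
Lemma sum_e_iter_sylv q p k x y :
  \sum_(i < 4) e_ R i * (x * iter k (sylv q p) (e_ R i * y)) =
  - 2 *: iter k (sylv (quat_conj q) p) (quat_conj x * y).
Proof.
elim: k x => [|k IH] x; first exact: sum_e_mul.
have -> : \sum_(i < 4) e_ R i * (x * iter k.+1 (sylv q p) (e_ R i * y)) =
    \sum_(i < 4) e_ R i * ((x * q) * iter k (sylv q p) (e_ R i * y)) -
    (\sum_(i < 4) e_ R i * (x * iter k (sylv q p) (e_ R i * y))) * p.
  by rewrite mulr_suml -sumrB; apply: eq_bigr => i _; rewrite /= /sylv !mulrBr !mulrA.
rewrite !IH -scalerAl -scalerBr -iter_sylv_mulr // -iter_sylvB iterSr.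
congr (_ *: iter _ _ _); rewrite /sylv; congr (_ - _).
by rewrite mulrA; congr (_ * _); quat_ring.
Qed.

Lemma sum_e_iter q p k y :
  \sum_(i < 4) e_ R i * iter k (sylv q p) (e_ R i * y) =
  - 2 *: iter k (sylv (quat_conj q) p) y.
Proof.
have := sum_e_iter_sylv q p k 1 y.
have -> : quat_conj 1 = 1 :> quat R by quat_ring.
by rewrite mul1r => <-; apply: eq_bigr => i _; rewrite mul1r.
Qed.

Definition sprod q p m k := iter m (sylv q p) (iter k (sylv (quat_conj q) p) 1).

Lemma sum_e_spow1 q p n :
  \sum_(i < 4) e_ R i * spow1 q p (e_ R i) n =
  - 2 *: \sum_(k < n) sprod q p (n - k.+1) k.
Proof.
under eq_bigr => i _ do
  rewrite (@iter_unroll _ (sylv q p) (spow1 q p (e_ R i)) (fun m => e_ R i * spow q p m)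
    (sylvD q p) erefl (fun=> erefl)) mulr_sumr.
rewrite exchange_big /= scaler_sumr; apply: eq_bigr => k _.
by rewrite sum_e_iter /sprod iter_sylv_conj_comm.
Qed.

(** The basis sum acts on the inner e A^k e only. The outer power A^l completes the exponent of A to
    n - k whatever l is, so each k is counted once per admissible l. *)
Lemma sum_spow2 q p n :
  \sum_(i < 4) spow2 q p (e_ R i) n.+2 =
  - 2 *: \sum_(k < n.+1) sprod q p (n - k) k *+ (n - k).+1.
Proof.
under eq_bigr => i _ do
  rewrite (@iter_unroll _ (sylv q p) (spow2 q p (e_ R i)) (fun m => e_ R i * spow1 q p (e_ R i) m)
    (sylvD q p) erefl (fun=> erefl)).
rewrite exchange_big /=.
under eq_bigr => l _ do rewrite -iter_sylv_sum sum_e_spow1 iter_sylvZ iter_sylv_sum.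
rewrite -scaler_sumr; congr (_ *: _).
(* For l = n + 1 the inner sum is empty. *)
rewrite big_ord_recr /= subnn big_ord0 addr0.
rewrite [RHS](eq_bigr (fun k : 'I_n.+1 => sprod q p (n - k) k *+ (n.+1 - k))); last first.
  by move=> k _; rewrite subSn // -ltnS.
rewrite -(sum_triangle (fun k => sprod q p (n - k) k)).
apply: eq_bigr => l _; rewrite subSS; apply: eq_bigr => k _.
rewrite /sprod -iterD; congr iter.
by have := ltn_ord k; have := ltn_ord l; lia.
Qed.

Section Inverse.
Variables q p : quat R.
Hypothesis qp : 0 < inner_radius q p.
Let P := quadr q p.

Lemma quadrX_comm k : P^-1 ^+ k * p = p * P^-1 ^+ k.
Proof. by apply/esym/commrX/commrV/esym/quadr_comm. Qed.

(** A^(-1) is B followed by right multiplication by P^(-1), and these commute because P commutes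
    with p. *)
Lemma iter_isylv k y :
  iter k (isylv q p) y = iter k (sylv (quat_conj q) p) y * P^-1 ^+ k.
Proof.
elim: k => [|k IH] /=; first by rewrite mulr1.
by rewrite IH /isylv sylv_mulr ?quadrX_comm // exprSr mulrA.
Qed.

Lemma iter_isylv_sum k n (F : 'I_n -> quat R) :
  iter k (isylv q p) (\sum_i F i) = \sum_i iter k (isylv q p) (F i).
Proof.
by rewrite iter_isylv iter_sylv_sum mulr_suml; apply: eq_bigr => i _; rewrite iter_isylv.
Qed.

Lemma sprodSS m k : sprod q p m.+1 k.+1 = sprod q p m k * P.
Proof.
rewrite /sprod iterSr /= sylv_conj iter_sylv_mulr //; exact: quadr_comm.
Qed.

(** A^(-m-1) contributes B^(m+1) P^(-m-1), and one pair A B cancels one P. *)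
Lemma iter_sylv_ipow k m :
  iter k.+1 (sylv q p) (ipow q p m.+1) * P^-1 ^+ k.+1 = sprod q p k m * P^-1 ^+ (k + m.+1).
Proof.
have u : P \is a GRing.unit by exact: quadr_neq0.
rewrite /ipow iter_isylv iter_sylv_mulr ?quadrX_comm // -/(sprod q p k.+1 m.+1).
by rewrite sprodSS -2!mulrA -exprD addSn exprS mulVKr // addnC addSnnS.
Qed.

Lemma iter_isylv_sprod l k m j :
  iter l (isylv q p) (sprod q p k m * P^-1 ^+ j) = sprod q p k (l + m) * P^-1 ^+ (j + l).
Proof.
rewrite iter_isylv iter_sylv_mulr ?quadrX_comm // -mulrA -exprD.
by rewrite /sprod -iter_sylv_conj_comm -iterD.
Qed.

Lemma sum_e_ipow1 n :
  \sum_(i < 4) e_ R i * ipow1 q p (e_ R i) n =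
  2 *: \sum_(k < n) sprod q p k (n - k.+1) * P^-1 ^+ n.
Proof.
have E i : ipow1 q p (e_ R i) n =
    \sum_(k < n) iter k.+1 (isylv q p) (- (e_ R i * ipow q p (n - k))).
  rewrite (@iter_unroll _ (isylv q p) (ipow1 q p (e_ R i))
    (fun m => isylv q p (- (e_ R i * ipow q p m.+1))) (isylvD q p) erefl).
    by apply: eq_bigr => k _; rewrite -iterSr subnSK.
  by move=> m; rewrite /= isylvD.
under eq_bigr => i _ do rewrite E mulr_sumr.
rewrite exchange_big /= scaler_sumr; apply: eq_bigr => k _.
under eq_bigr => i _ do rewrite -iterS -mulrN iter_isylv mulrA.
(* The inverse powers are written with B, so the basis sum turns B into A here. *)
rewrite -mulr_suml sum_e_iter quat_conjK.
rewrite -(subnSK (ltn_ord k)) (_ : - ipow q p _ = -1 *: ipow q p (n - k.+1).+1); last first.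
  by rewrite scaleN1r.
rewrite iter_sylvZ scalerA mulrN1 opprK -scalerAl iter_sylv_ipow.
by rewrite -addSnnS subnKC.
Qed.

(** The outer A^(-l-1) = B^(l+1) P^(-l-1) completes the exponents of B and P^(-1) to n - k and n + 1
    for every l, so each k occurs n - k times. *)
Lemma sum_ipow2 n :
  \sum_(i < 4) ipow2 q p (e_ R i) n =
  - 2 *: ((\sum_(k < n) sprod q p k (n - k) *+ (n - k)) * P^-1 ^+ n.+1).
Proof.
have E i : ipow2 q p (e_ R i) n =
    \sum_(l < n) iter l.+1 (isylv q p) (- (e_ R i * ipow1 q p (e_ R i) (n - l))).
  rewrite (@iter_unroll _ (isylv q p) (ipow2 q p (e_ R i))
    (fun m => isylv q p (- (e_ R i * ipow1 q p (e_ R i) m.+1))) (isylvD q p) erefl).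
    by apply: eq_bigr => k _; rewrite -iterSr subnSK.
  by move=> m; rewrite /= isylvD.
rewrite -(sum_triangle (fun k => sprod q p k (n - k))) mulr_suml scaler_sumr.
under eq_bigr => i _ do rewrite E.
rewrite exchange_big; apply: eq_bigr => l _.
rewrite -iter_isylv_sum sumrN sum_e_ipow1 -scaleNr iter_isylv iter_sylvZ -scalerAl.
congr (_ *: _); rewrite -iter_isylv iter_isylv_sum mulr_suml.
apply: eq_bigr => k _; rewrite iter_isylv_sprod.
by congr (sprod _ _ _ _ * _ ^+ _); have := ltn_ord k; have := ltn_ord l; lia.
Qed.

End Inverse.

(** Binomial theorem for the commuting operators L_q and - R_p. *)
Lemma iter_sylv_binomial q p n y :
  iter n (sylv q p) y = \sum_(i < n.+1) (q ^+ i * y * (- p) ^+ (n - i)) *+ 'C(n, i).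
Proof.
elim: n => [|n IH]; first by rewrite big_ord1 /= mulr1 mul1r.
rewrite big_ord_recl /= bin0 mulr1n mul1r subn0.
under [in RHS]eq_bigr => i _ do rewrite binS mulrnDr subSS.
rewrite big_split /= addrA addrC IH /sylv -mulrN; congr (_ + _).
  by rewrite mulr_sumr; apply: eq_bigr => i _; rewrite exprS mulrnAr !mulrA.
rewrite mulr_suml big_ord_recl [in RHS]big_ord_recr /= (bin_small (ltnSn n)) mulr0n addr0.
rewrite bin0 mulr1n mul1r subn0 -mulrA -exprSr; congr (_ + _).
apply: eq_bigr => i _; rewrite mulrnAl -!mulrA -exprSr /bump add1n subnSK //.
Qed.

Lemma spowE q p n : starpow q p n = spow q p n.
Proof.
by rewrite /spow iter_sylv_binomial; apply: eq_bigr => i _; rewrite mulr1.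
Qed.

Lemma sprodE q p m k : starprod q p m k = sprod q p m k.
Proof.
rewrite /sprod iter_sylv_binomial; apply: eq_bigr => i _.
rewrite iter_sylv_binomial mulr_sumr mulr_suml -sumrMnl; apply: eq_bigr => j _.
rewrite mulr1 mulrnAr mulrnAl -mulrnA mulnC; congr (_ *+ _).
by rewrite -!mulrA -exprD addnC.
Qed.

(** A composed with L_q - R_(conj p) is left multiplication by Q, a real polynomial in q. Hence
    [starpowN] inverts A^n through Q on the left, while [isylv] inverts A through P on the right. *)
Lemma ipowE q p n : 0 < inner_radius q p -> starpowN q p n = ipow q p n.
Proof.
move=> qp; pose Q := q ^+ 2 - (2 * q0 p) *: q + (`|p| ^+ 2)%:A.
have Qq : Q * q = q * Q by rewrite /Q quat_sqrnorm !expr2; quat_ring.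
have SS y : sylv q p (sylv q (quat_conj p) y) = Q * y.
  by rewrite /Q quat_sqrnorm /sylv !expr2; quat_ring.
have Qn0 : Q != 0.
  apply/eqP => Q0.
  have : sylv q p (sylv q (quat_conj p) 1) = sylv q p 0.
    by rewrite SS Q0 /sylv mul0r mulr0 mul0r subrr.
  move/(sylv_inj qp); rewrite /sylv mulr1 mul1r => /eqP; rewrite subr_eq0 => /eqP e.
  by move: qp; rewrite e -{2}(quat_conjK p) inner_radius_conj ltxx.
have uQ : Q \is a GRing.unit by exact: Qn0.
have QX k : iter k (sylv q p) (iter k (sylv q (quat_conj p)) 1) = Q ^+ k.
  elim: k => [//|k IH]; rewrite iterSr iterS SS iter_sylv_mull ?IH ?exprS //.
have inv k y : iter k (isylv q p) (iter k (sylv q p) y) = y.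
  by elim: k y => [//|k IH] y; rewrite iterSr iterS isylvK.
(* Write 1 as Q^(-n) Q^n and pull A^n out; Q^(-n) passes through A since Q commutes with q. *)
rewrite /ipow -[1](mulVr (unitrX n uQ)) -{2}QX -iter_sylv_mull; last first.
  by apply/esym/commrV/commrX/esym.
by rewrite inv /starpowN spowE.
Qed.

End LaplacianOfPowers.

(** * The annular domain in terms of the two radii *)

Section AnnularDomain.
Variable R : realType.
Implicit Types (p q e I J : quat R).

Lemma eq_sqrtr (a b : R) : 0 <= a -> a ^+ 2 = b -> a = Num.sqrt b.
Proof. by move=> a0 <-; rewrite sqrtr_sqr ger0_norm. Qed.

Lemma unit_sphere_normsq I : unit_sphere I ->
  q1 I ^+ 2 + q2 I ^+ 2 + q3 I ^+ 2 = 1.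
Proof.
move=> [I0 I1]; have := quat_sqrnorm I.
by rewrite I1 expr1n /quat_normsq I0 expr0n /= add0r => ->.
Qed.

Lemma slice_dist I (x y c s : R) : unit_sphere I ->
  `|x%:A + y *: I - (c%:A + s *: I)| = Num.sqrt ((x - c) ^+ 2 + (y - s) ^+ 2).
Proof.
move=> Iu; apply: eq_sqrtr => //; rewrite quat_sqrnorm.
rewrite -[(y - s) ^+ 2]mulr1 -(unit_sphere_normsq Iu).
by case: Iu => I0 _; rewrite /quat_normsq /= I0; ring.
Qed.

Lemma slice_im_norm I (x y : R) : unit_sphere I -> `|quat_im (x%:A + y *: I)| = `|y|.
Proof.
move=> Iu; rewrite -[RHS]sqrtr_sqr; apply: eq_sqrtr => //; rewrite quat_sqrnorm.
rewrite -[y ^+ 2]mulr1 -(unit_sphere_normsq Iu) /quat_normsq /=; ring.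
Qed.

Lemma slice_re I (x y : R) : unit_sphere I -> q0 (x%:A + y *: I) = x.
Proof. by move=> [I0 _]; rewrite /= I0; ring. Qed.

Lemma slice_decomposition q :
  exists2 I, unit_sphere I & q = (q0 q)%:A + `|quat_im q| *: I.
Proof.
have [im0|imN0] := eqVneq (quat_im q) 0.
  (* For real q every imaginary unit works; this one is e1. *)
  exists (e_ R (lift ord0 ord0)).
    by split; [|exact: quat_norm_e].
  rewrite im0 normr0 scale0r addr0; case: q im0 => a b c d [-> -> ->].
  by quat_ring.
have n0 : `|quat_im q| != 0 by rewrite normr_eq0.
exists (`|quat_im q|^-1 *: quat_im q).
  by split; rewrite /= ?mulr0 // normrZ normrV ?unitfE // normr_id mulVf.
by rewrite scalerA mulfV // scale1r; quat_ring.
Qed.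

(** The signs of [y] and [s] decide which of the points x + yI and x - yI is the nearer one to p. *)
Lemma radii_slice I J (x y c s : R) : unit_sphere I -> unit_sphere J ->
  let q := x%:A + y *: J in let p := c%:A + s *: I in
  let d1 := `|x%:A + y *: I - p| in let d2 := `|x%:A - y *: I - p| in
  (inner_radius q p = d1 /\ outer_radius q p = d2) \/
  (inner_radius q p = d2 /\ outer_radius q p = d1).
Proof.
move=> Iu Ju /=; rewrite -[- (y *: I)]scaleNr !slice_dist //.
rewrite /inner_radius /outer_radius !slice_im_norm // !slice_re //.
have sq (u v : R) : u = v \/ u = - v -> u ^+ 2 = v ^+ 2.
  by case=> ->; rewrite ?sqrrN.
have [y0|y0] := ger0P y; have [s0|s0] := ger0P s.
- by left; split; congr (Num.sqrt (_ + _)); apply: sq; right; ring.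
- by right; split; congr (Num.sqrt (_ + _)); apply: sq; right; ring.
- by right; split; congr (Num.sqrt (_ + _)); apply: sq; right; ring.
- by left; split; congr (Num.sqrt (_ + _)); apply: sq; right; ring.
Qed.

Lemma inner_le_outer q p : inner_radius q p <= outer_radius q p.
Proof.
rewrite ler_wsqrtr // lerD2l -[X in X <= _]real_normK ?num_real //.
rewrite lerXn2r ?nnegrE ?addr_ge0 // -[X in _ <= X + _]normr_id -[X in _ <= _ + X]normr_id.
exact: ler_normB.
Qed.

Lemma annular_domainE p R1 (R2 : \bar R) q : annular_domain p R1 R2 q <->
  R1 < inner_radius q p /\ ((outer_radius q p)%:E < R2)%E.
Proof.
split=> [[I [Iu [c [s pE]] [J [x [y [Ju [_ a1 b1] [_ a2 b2] qE]]]]]]|[h1 h2]].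
  have := radii_slice x y c s Iu Ju; rewrite /= -pE -qE.
  by case=> -[-> ->].
have [I Iu pE] := slice_decomposition p.
have [J Ju qE] := slice_decomposition q.
have h3 := lt_le_trans h1 (inner_le_outer q p).
have h4 : ((inner_radius q p)%:E < R2)%E.
  by apply: le_lt_trans h2; rewrite lee_fin inner_le_outer.
have rad := radii_slice (q0 q) `|quat_im q| (q0 p) `|quat_im p| Iu Ju.
rewrite /= -pE -qE in rad.
exists I; split => //; first by exists (q0 p), `|quat_im p|.
have z1 : exists x y : R, (q0 q)%:A + `|quat_im q| *: I = x%:A + y *: I.
  by exists (q0 q), `|quat_im q|.
have z2 : exists x y : R, (q0 q)%:A - `|quat_im q| *: I = x%:A + y *: I.
  by exists (q0 q), (- `|quat_im q|); rewrite scaleNr.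
exists J, (q0 q), `|quat_im q|; split => //.
  by case: rad => -[e1 e2]; split; rewrite -?e1 -?e2.
by case: rad => -[e1 e2]; split; rewrite -?e1 -?e2.
Qed.

(** [k] is plus or minus the norm of [quat_im p], which covers both radii at once. *)
Lemma radius_line_cvg p q e (k : R) :
  Num.sqrt ((q0 (t *: e + q) - q0 p) ^+ 2 + (`|quat_im (t *: e + q)| + k) ^+ 2)
    @[t --> (0 : R)] -->
  Num.sqrt ((q0 q - q0 p) ^+ 2 + (`|quat_im q| + k) ^+ 2).
Proof.
have ct : t @[t --> (0 : R)] --> (0 : R) by exact: cvg_id.
apply: continuous_cvg; first exact: sqrt_continuous.
have c1 : q0 (t *: e + q) - q0 p @[t --> (0 : R)] --> q0 q - q0 p.
  apply: cvgB; last exact: cvg_cst.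
  have := cvgD (cvgM ct (cvg_cst (q0 e))) (cvg_cst (q0 q)).
  by rewrite mul0r add0r; apply.
have c2 : `|quat_im (t *: e + q)| + k @[t --> (0 : R)] --> `|quat_im q| + k.
  apply: cvgD; last exact: cvg_cst.
  apply: cvg_norm.
  rewrite (_ : (fun t => quat_im (t *: e + q)) = fun t => t *: quat_im e + quat_im q).
    have := cvgD (cvgZr_tmp (a := quat_im e) ct) (cvg_cst (quat_im q)).
    by rewrite scale0r add0r; apply.
  by apply/funext => t; quat_ring.
by apply: cvgD; rewrite expr2; exact: cvgM.
Qed.

Lemma radii_line p q e (r1 r2 : R) : r1 < inner_radius q p -> outer_radius q p < r2 ->
  exists2 d, 0 < d & forall t, `|t| < d ->
    r1 < inner_radius (t *: e + q) p /\ outer_radius (t *: e + q) p < r2.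
Proof.
move=> h1 h2.
have n1 := cvgr_gt _ (@radius_line_cvg p q e (- `|quat_im p|)) _ h1.
have n2 := cvgr_lt _ (@radius_line_cvg p q e `|quat_im p|) _ h2.
have [d d0 nd] := (nbhs_normP _ _).1 (filterI (n1 _) (n2 _)).
by exists d => // t td; apply: nd; rewrite /ball_ /= sub0r normrN.
Qed.

End AnnularDomain.

(** * Termwise second derivatives of the expansion, and the Laplacian *)

Lemma reciprocal_radius (R : realType) (x : R) (y : \bar R) : 0 <= x -> (x%:E < y)%E ->
  exists r l : R, [/\ x < r, (r%:E < y)%E, 0 < l, r * l < 1 & (y^-1 < l%:E)%E].
Proof.
move=> x0; case: y => [y| |] //; last first.
  move=> _; exists (x + 1), ((x + 2)^-1); split.
  - by rewrite ltrDl.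
  - exact: ltry.
  - by rewrite invr_gt0 ltr_wpDl.
  - by rewrite ltr_pdivrMr ?ltr_wpDl //; lra.
  - by rewrite invey lte_fin invr_gt0 ltr_wpDl.
rewrite lte_fin => xy; have y0 := le_lt_trans x0 xy.
(* x < r < r' < y: [r] bounds the operator and 1 / r' the coefficient growth, so their product is
   below 1. *)
pose r := (x + y) / 2; pose r' := (r + y) / 2.
have xr : x < r by rewrite /r; lra.
have ry : r < y by rewrite /r; lra.
have rr' : r < r' by rewrite /r'; lra.
have r'y : r' < y by rewrite /r'; lra.
have r'0 : 0 < r' by apply: le_lt_trans x0 _; apply: lt_trans rr'.
exists r, r'^-1; split => //; rewrite ?invr_gt0 //.
- by rewrite ltr_pdivrMr ?mul1r.
- by rewrite inver gt_eqF // lte_fin ltf_pV2.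
Qed.

Lemma second_derivative_laurent (R : realType) (f : quat R -> quat R) (p : quat R)
    (a : int -> quat R) (R1 : R) (R2 : \bar R) (i : 'I_4) (q : quat R) :
  (R2^-1)%E = limsup_root (fun n => a n%:Z) ->
  R1%:E = limsup_root (fun n => a (- n%:Z)) ->
  0 < R1 ->
  (forall x, annular_domain p R1 R2 x ->
    f x = limn (psum 0 (fun n => starpow x p n * a n%:Z)) +
          limn (psum 1 (fun n => starpowN x p n * a (- n%:Z)))) ->
  annular_domain p R1 R2 q ->
  let pos n := spow2 q p (e_ R i) n * a n%:Z in
  let neg n := ipow2 q p (e_ R i) n * a (- n%:Z) in
  [/\ cvgn (psum 0 pos), cvgn (psum 1 neg) &
      'D_(e_ R i) ('D_(e_ R i) f) q = 2 *: (limn (psum 0 pos) + limn (psum 1 neg))].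
Proof.
move=> hR2 hR1 R10 fE /annular_domainE[qin qout] pos neg.
set e := e_ R i.
have e1 : `|e| = 1 by exact: quat_norm_e.
have [r [l [xr ry l0 rl lim1]]] := reciprocal_radius (sqrtr_ge0 _) qout.
have r0 : 0 < r by rewrite (le_lt_trans _ xr) // sqrtr_ge0.
(* R1 < l' < s < inner radius: [s^-1] bounds A^(-1) near q, [l'] the growth of the negative
   coefficients, and l' / s < 1. *)
pose s := (R1 + inner_radius q p) / 2; pose l' := (R1 + s) / 2.
have R1s : R1 < s by rewrite /s; lra.
have s_in : s < inner_radius q p by rewrite /s; lra.
have s0 : 0 < s := lt_trans R10 R1s.
have l'0 : 0 < l' by rewrite /l'; lra.
have l's : l' < s by rewrite /l'; lra.
have R1l' : R1 < l' by rewrite /l'; lra.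
have [d d0 line] := radii_line e s_in xr.
pose x t := t *: e + q.
have xh t h : x (t + h) = x t + h *: e by rewrite /x scalerDl addrAC.
have x0 : x 0 = q by rewrite /x scale0r add0r.
have xin t : `|t| < d -> 0 < inner_radius (x t) p.
  by move=> /line[/(lt_trans s0)].
have sylv_le t y : `|t| < d -> `|sylv (x t) p y| <= r * `|y|.
  move=> /line[_ /ltW h]; apply: (le_trans (sylv_norm_le _ _ _)).
  by rewrite ler_wpM2r.
have sylv_ge t y : `|t| < d -> `|y| <= s^-1 * `|sylv (x t) p y|.
  move=> /line[/ltW h _]; rewrite mulrC ler_pdivlMr // mulrC.
  by apply: le_trans (sylv_norm_ge _ _ _); rewrite ler_wpM2r.
have cpos : cvgn (series (fun n => n.+1%:R ^+ 3 * r ^+ n * `|a n%:Z|)).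
  by apply: (is_cvg_series_limsup_root (l := l)); rewrite ?(ltW r0) // -hR2.
have cneg : cvgn (series (fun n => n.+1%:R ^+ 3 * s^-1 ^+ n * `|a (- n%:Z)|)).
  apply: (is_cvg_series_limsup_root (l := l')) => //.
  - by rewrite invr_ge0 ltW.
  - by rewrite mulrC ltr_pdivrMr ?mul1r.
  - by rewrite -hR1 lte_fin.
have ri0 : 0 <= r^-1 by rewrite invr_ge0 ltW.
have si0 : 0 <= s^-1 by rewrite invr_ge0 ltW.
have [|Tpos Cpos] := @taylor2_power_series R 0 d (fun n t => spow (x t) p n)
  (fun n t => spow1 (x t) p e n) (fun n t => spow2 (x t) p e n) (fun n => a n%:Z)
  r r^-1 (ltW r0) ri0 cpos
  (fun n t td => And3 (spow_norm r0 (fun y => sylv_le t y td) n)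
     (spow1_norm r0 e1 (fun y => sylv_le t y td) n)
     (spow2_norm r0 e1 (fun y => sylv_le t y td) n)).
  move=> n t h td thd; rewrite xh; apply: spow_taylor_norm => // y.
    exact: sylv_le.
  by rewrite -xh; exact: sylv_le.
have [|Tneg Cneg] := @taylor2_power_series R 1 d (fun n t => ipow (x t) p n)
  (fun n t => ipow1 (x t) p e n) (fun n t => ipow2 (x t) p e n) (fun n => a (- n%:Z))
  s^-1 s^-1 si0 si0 cneg
  (fun n t td => And3 (ipow_norm si0 (xin t td) (fun y => sylv_ge t y td) n)
     (ipow1_norm si0 e1 (xin t td) (fun y => sylv_ge t y td) n)
     (ipow2_norm si0 e1 (xin t td) (fun y => sylv_ge t y td) n)).
  move=> n t h td thd; rewrite xh; apply: ipow_taylor_norm => //.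
  - exact: xin.
  - by move=> y; exact: sylv_ge.
  - by rewrite -xh; exact: xin.
  - by move=> y; rewrite -xh; exact: sylv_ge.
have z0 : `|0 : R| < d by rewrite normr0.
have {}Cpos := Cpos 0 z0; have {}Cneg := Cneg 0 z0.
rewrite x0 in Cpos Cneg; split => //.
rewrite (taylor2_derive2 d0 (taylor2D Tpos Tneg)) /= ?x0 //.
move=> t td; have [h1 h2] := line t td.
rewrite fE; last first.
  apply/annular_domainE; split; first exact: lt_trans h1.
  by apply: lt_trans ry; rewrite lte_fin.
congr (limn (psum _ _) + limn (psum _ _)); apply/funext => n.
  by rewrite spowE.
by rewrite ipowE // xin.
Qed.

Theorem theorem8p7 (R : realType) (Omega : set (quat R))
    (f : quat R -> quat R) (p : quat R) (a c : int -> quat R)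
    (R1 : R) (R2 : \bar R) :
  open Omega -> axially_symmetric Omega ->
  left_slice_hyperholomorphic Omega f ->
  (R2^-1)%E = limsup_root (fun n => a n%:Z) ->
  R1%:E = limsup_root (fun n => a (- n%:Z)) ->
  0 < R1 -> (R1%:E < R2)%E ->
  annular_domain p R1 R2 `<=` Omega ->
  laurent_expansion (annular_domain p R1 R2) f p a ->
  (forall n : nat, c n%:Z = - (2 * n.+1%:R * n.+2%:R) *: a n.+2%:Z) ->
  (forall n : nat, (1 <= n)%N -> c (- n%:Z) = - 4 *: a (- n%:Z)) ->
  forall q, annular_domain p R1 R2 q ->
  let pos n := Qtilde n q p * c n%:Z in
  let neg n := Mpoly n q p * QcN p n.+1 q * c (- n%:Z) in
  [/\ cvgn (psum 0 pos), cvgn (psum 1 neg) &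
      laplacian f q = limn (psum 0 pos) + limn (psum 1 neg)].
Proof.
move=> _ _ _ hR2 hR1 R10 _ _ [_ fE] cpos cneg q Dq pos neg.
have D i := second_derivative_laurent i hR2 hR1 R10 fE Dq.
have qp : 0 < inner_radius q p by case/annular_domainE: Dq => /(lt_trans R10).
(* Both sides carry the factor -4: 2 from the second Taylor coefficient times -2 from the basis sum,
   against 2 / ((n+1)(n+2)) times -2 (n+1)(n+2). *)
have posE n : 2 *: ((\sum_(i < 4) spow2 q p (e_ R i) n.+2) * a n.+2%:Z) = pos n.
  rewrite sum_spow2; set S := \sum_(k < n.+1) _.
  have -> : pos n = (2 / (n.+1%:R * n.+2%:R) *: S) * (- (2 * n.+1%:R * n.+2%:R) *: a n.+2%:Z).
    rewrite /pos cpos; congr (_ * _); rewrite /Qtilde -[RHS]scalerA; congr (_ *: _).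
    rewrite scaler_sumr; apply: eq_bigr => k _.
    by rewrite sprodE -(@scaler_nat R _ _ (sprod _ _ _ _)) [RHS]scalerA mulrC.
  rewrite -(scalerAl _ S) -(scalerAl _ S) -(scalerAr _ S) !scalerA.
  congr (_ *: _); field.
  by rewrite -[1]/(1%:R) -[2]/(2%:R) -!natrD !pnatr_eq0.
have negE n : (1 <= n)%N ->
    2 *: ((\sum_(i < 4) ipow2 q p (e_ R i) n) * a (- n%:Z)) = neg n.
  move=> n1; rewrite sum_ipow2 // /neg cneg // -scalerAl -scalerAr !scalerA.
  congr (_ *: (_ * _)); last first.
    rewrite /QcN -exprVn; congr (_ * _).
    (* The term j = n of [Mpoly] has multiplicity 0. *)
    by rewrite /Mpoly big_ord_recr /= subnn mulr0n addr0; apply: eq_bigr => k _; rewrite sprodE.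
  by ring.
pose A i := psum 0 (fun n => spow2 q p (e_ R i) n * a n%:Z).
pose B i := psum 1 (fun n => ipow2 q p (e_ R i) n * a (- n%:Z)).
have sum_cvg (u : 'I_4 -> nat -> quat R) : (forall i, cvgn (u i)) ->
    2 *: \sum_(i < 4) u i N @[N --> \oo] --> 2 *: \sum_(i < 4) limn (u i).
  by move=> cu; apply: cvgZl_tmp; apply: cvg_big => [|i _]; [exact: add_continuous|exact: cu].
have cA : 2 *: \sum_(i < 4) A i N @[N --> \oo] --> 2 *: \sum_(i < 4) limn (A i).
  by apply: sum_cvg => i; case: (D i).
have cB : 2 *: \sum_(i < 4) B i N @[N --> \oo] --> 2 *: \sum_(i < 4) limn (B i).
  by apply: sum_cvg => i; case: (D i).
have cpos' : psum 0 pos @ \oo --> 2 *: \sum_(i < 4) limn (A i).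
  (* The second-order coefficients of the powers 0 and 1 vanish, so [pos] starts at the power 2. *)
  rewrite (_ : psum 0 pos = fun N => 2 *: \sum_(i < 4) A i (N + 2)%N).
    by rewrite (cvg_shiftn 2 (fun N => 2 *: \sum_(i < 4) A i N)).
  apply/funext => N; rewrite /A /psum exchange_big /= addn2 !big_nat_recl //.
  rewrite [X in X + _]big1 ?add0r => [|i _]; last by rewrite mul0r.
  rewrite [X in X + _]big1 ?add0r => [|i _]; last first.
    by rewrite /= /sylv !mulr0 !mul0r subrr add0r mul0r.
  by rewrite scaler_sumr; apply: eq_bigr => n _; rewrite -mulr_suml posE.
have cneg' : psum 1 neg @ \oo --> 2 *: \sum_(i < 4) limn (B i).
  rewrite (_ : psum 1 neg = fun N => 2 *: \sum_(i < 4) B i N) //.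
  apply/funext => N; rewrite /B /psum exchange_big /= scaler_sumr.
  by apply: eq_big_nat => n /andP[n1 _]; rewrite -mulr_suml negE.
split; [by apply/cvg_ex; eexists; exact: cpos'|by apply/cvg_ex; eexists; exact: cneg'|].
rewrite (cvg_lim _ cpos') // (cvg_lim _ cneg') // -scalerDr -big_split scaler_sumr.
by apply: eq_bigr => i _; case: (D i).
Qed.
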